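(* For integers $k\ge2$ and $n\ge0$ let \[ J_k(n)=\sum_{r=1}^{k-1}2^k\int_{[0,1]^k}\frac{(1-u_1^4\cdots u_r^4)^n(1-u_{r+1}^4\cdots u_k^4)^n}{(1-u_1^2\cdots u_k^2)^{2n+1}}\,du_1\cdots du_k , \] set $J_0(n)=0$, $J_1(n)=\frac{2^nn!}{(2n+1)!!}$, and let $w_k(z)=\sum_{n\ge0}J_k(n)z^n$ for $k\ge0$. Then for every $k\ge2$, \[ \left\{z(1-z)^2\frac{d^2}{dz^2}+(1-z)(1-3z)\frac{d}{dz}+z-\frac34\right\}w_k(z)=w_{k-2}(z). \] *)

(* Defs.v *)
From HB Require Import structures.
From mathcomp Require Import all_boot all_order all_algebra.
From mathcomp Require Import complex.
From mathcomp Require Import all_classical all_reals all_analysis.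

Set Implicit Arguments.
Unset Strict Implicit.
Unset Printing Implicit Defensive.

Import Order.TTheory GRing.Theory Num.Theory.
Import numFieldNormedType.Exports.

Local Open Scope classical_set_scope.
Local Open Scope ring_scope.

Notation tupleR k R := (k.-tuple (measurableTypeR R)).

Definition pair_cons (R : realType) (k : nat)
  (p : measurableTypeR R * tupleR k R) : tupleR k.+1 R :=
  [tuple of p.1 :: p.2].

Definition tuple_uncons (R : realType) (k : nat)
  (u : tupleR k.+1 R) : measurableTypeR R * tupleR k R :=
  (thead u, [tuple of behead u]).

Section lebesgue_cons.
Variables (R : realType) (k : nat).

Lemma pair_consK : cancel (@pair_cons R k) (@tuple_uncons R k).
Proof. by move=> [x t]; congr pair; apply: val_inj. Qed.

Lemma tuple_unconsK : cancel (@tuple_uncons R k) (@pair_cons R k).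
Proof. by move=> u; rewrite [RHS]tuple_eta; apply: val_inj. Qed.

Lemma measurable_pair_cons : measurable_fun setT (@pair_cons R k).
Proof. exact: measurable_cons. Qed.

Lemma measurable_tuple_uncons : measurable_fun setT (@tuple_uncons R k).
Proof.
apply/measurable_fun_pairP; split; first exact: measurable_tnth.
exact: measurable_behead.
Qed.

Variable mu : {sigma_finite_measure set (tupleR k R) -> \bar R}.

Definition lebesgue_cons : set (tupleR k.+1 R) -> \bar R :=
  pushforward (@lebesgue_measure R \x mu)%E (@pair_cons R k).

Let lebesgue_cons0 : lebesgue_cons set0 = 0%E.
Proof. by rewrite /lebesgue_cons /pushforward preimage_set0 measure0. Qed.

Let lebesgue_cons_ge0 A : (0 <= lebesgue_cons A)%E.
Proof. by rewrite /lebesgue_cons /pushforward measure_ge0. Qed.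

Let lebesgue_cons_sigma_additive : semi_sigma_additive lebesgue_cons.
Proof.
by apply: measure_semi_sigma_additive => //; exact: measurable_pair_cons.
Qed.

HB.instance Definition _ := isMeasure.Build _ _ _ lebesgue_cons
  lebesgue_cons0 lebesgue_cons_ge0 lebesgue_cons_sigma_additive.

Let lebesgue_cons_sigma_finite : sigma_finite setT lebesgue_cons.
Proof.
have /sigma_finiteP[F [TF ndF Foo]] := sigma_finiteT (@lebesgue_measure R).
have /sigma_finiteP[G [TG ndG Goo]] := sigma_finiteT mu.
exists (fun i => @tuple_uncons R k @^-1` (F i `*` G i)).
  rewrite -preimage_bigcup (_ : \bigcup_i _ = setT) ?preimage_setT//.
  apply/seteqP; split=> // -[x t] _.
  have [i _ Fix] : (\bigcup_i F i) x by rewrite -TF.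
  have [j _ Gjt] : (\bigcup_i G i) t by rewrite -TG.
  exists (maxn i j) => //; split => /=.
    by move: x Fix; exact/subsetPset/ndF/leq_maxl.
  by move: t Gjt; exact/subsetPset/ndG/leq_maxr.
move=> i; have [mF muF] := Foo i; have [mG muG] := Goo i; split.
  rewrite -[X in measurable X]setTI.
  by apply: measurable_tuple_uncons => //; exact: measurableX.
rewrite /lebesgue_cons /pushforward -comp_preimage.
rewrite (_ : _ \o _ = id) ?preimage_id; last exact/funext/pair_consK.
by rewrite product_measure1E// lte_mul_pinfty// ge0_fin_numE.
Qed.

HB.instance Definition _ := Measure_isSigmaFinite.Build _ _ _ lebesgue_cons
  lebesgue_cons_sigma_finite.

End lebesgue_cons.

(* Lebesgue measure on R^k, as the k-fold product of the Lebesgue measure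
   on R; it is characterized by lebesgue_tuple_box below. *)
Fixpoint lebesgue_tuple (R : realType) (k : nat) :
    {sigma_finite_measure set (tupleR k R) -> \bar R} :=
  if k is k'.+1 then lebesgue_cons (lebesgue_tuple R k')
  else \d_([tuple] : tupleR 0 R).

Lemma lebesgue_tuple_box (R : realType) (k : nat)
    (A : 'I_k -> set (measurableTypeR R)) : (forall i, measurable (A i)) ->
  lebesgue_tuple R k [set u | forall i, A i (tnth u i)] =
  (\prod_(i < k) lebesgue_measure (A i))%E.
Proof.
elim: k A => [|k IH] A mA.
  rewrite big_ord0 /= diracE mem_set//= => -[].
  by [].
rewrite big_ord_recl -IH//= /lebesgue_cons /pushforward.
rewrite -product_measure1E//.
  congr (_ _); apply/seteqP; split => [[x t]/= h|[x t]/= [h0 h] i].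
    split; first by have := h ord0.
    by move=> i; have := h (lift ord0 i); rewrite tnthS.
  by case: (unliftP ord0 i) => [j ->|->//]; rewrite tnthS; exact: h.
rewrite (_ : mkset _ =
    \bigcap_(i in [set: 'I_k]) ((fun u : tupleR k R => tnth u i) @^-1` A (lift ord0 i))).
  apply: fin_bigcap_measurable => // i _.
  by rewrite -[X in measurable X]setTI; exact: measurable_tnth.
by apply/seteqP; split => u h i => [_|]; exact: h.
Qed.

Definition unit_cube (R : realType) (k : nat) : set (tupleR k R) :=
  [set u | forall i, 0 <= tnth u i <= 1].

Arguments unit_cube : clear implicits.

(* u_1, ..., u_k is stored as tnth u 0, ..., tnth u (k - 1).  The integrand
   takes the value 0 (division by 0) at the corner u = (1, ..., 1). *)
Definition J_integrand (R : realType) (k n r : nat) (u : tupleR k R) : R :=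
  (1 - \prod_(i < k | (i < r)%N) tnth u i ^+ 4) ^+ n *
  (1 - \prod_(i < k | (r <= i)%N) tnth u i ^+ 4) ^+ n /
  (1 - \prod_(i < k) tnth u i ^+ 2) ^+ (2 * n + 1).

(* (2n + 1)!! *)
Definition odd_dfact (n : nat) : nat := \prod_(i < n.+1) (2 * i + 1).

Definition J (R : realType) (k n : nat) : R :=
  match k with
  | 0 => 0
  | 1 => (2 ^ n * n`!)%:R / (odd_dfact n)%:R
  | _ => \sum_(1 <= r < k)
           2 ^+ k * \int[lebesgue_tuple R k]_(u in unit_cube R k) J_integrand n r u
  end.

(* R[i] as a numFieldType, which gives it the topology of the modulus. *)
Definition Cplx (R : realType) : numFieldType := complex R.

Definition RtoC (R : realType) (x : R) : Cplx R := (x%:C)%C.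

Definition w_term (R : realType) (k : nat) (z : Cplx R) (n : nat) : Cplx R :=
  RtoC (J R k n) * z ^+ n.

Arguments w_term : clear implicits.

Definition w (R : realType) (k : nat) (z : Cplx R) : Cplx R :=
  limn (series (w_term R k z)).

Arguments w : clear implicits.

(* Main.v *)
Require Import Defs.
From HB Require Import structures.
From mathcomp Require Import all_boot all_order all_algebra.
From mathcomp Require Import complex.
From mathcomp Require Import all_classical all_reals all_analysis.
From mathcomp Require Import measurable_realfun ring lra zify.
Import Order.TTheory GRing.Theory Num.Theory.
Import numFieldNormedType.Exports.
Local Open Scope classical_set_scope.
Local Open Scope ring_scope.

(* The integrand of [J_k(n)] only depends on the products [x] and [y] of the first
   [r] and of the last [k - r] variables, whose densities are powers of logarithms;
   summing over [r] with the binomial theorem leaves the single weight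
   [(- log (x y))^(k-2) / (k-2)!].  At fixed [p = x y], the substitution of
   [integral_kern] turns the remaining integral over [x] into one with fixed bounds:
     [J_k(n) = 2^(k-1) int_0^1 (- log p)^(k-2) / (k-2)!
        int_{-1}^1 (1 - y^2)^n (4 p^2 + (1 - p^2)^2 y^2)^(-1/2) dy dp].
   Put [G = p (4 p^2 + (1 - p^2)^2 y^2)^(-1/2)].  Up to an exact [y]-derivative,
   [(1 - y^2)^n (p d/dp)^2 G / 4] is the second order difference operator in [n] below
   applied to [(1 - y^2)^n G].  Two integrations by
   parts in [log p] lower [k] by two and give
     [(n+1)^2 J_k(n+1) - (2n^2 + 2n + 3/4) J_k(n) + n^2 J_k(n-1) = J_{k-2}(n)],
   the boundary term at [p = 1] producing [J_1(n)] when [k = 3].  Since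
   [J_k(n) <= J_k(0)], the series converge on the unit disk and the recurrence is
   the differential equation read on coefficients. *)

Set Implicit Arguments.
Unset Strict Implicit.
Unset Printing Implicit Defensive.

(** The substitution decouples the parameters. The power [2n + 1] of the denominator cancels
    exactly, so that [n] enters only through [(1 - y^2)^n] and [p] only through the square root,
    over a fixed rectangle. An operator in [n] can then be traded for one in [p], and [p d/dp] sends
    the weight [(-log p)^m / m!] to [-(-log p)^(m-1) / (m-1)!]; the constant weight of [k = 2] is
    killed at once, whence [w_0 = 0]. At [p = 1] one has [G = 1/2] whatever [y], so the boundary
    term is a multiple of the Wallis integral of [(1 - y^2)^n].

    The obstacle is [p = 0]. Up to the double integral everything is nonnegative and Tonelli
    suffices, but [(p d/dp)^2 G / p] changes sign and is unbounded near [p = y = 0]. Integrals are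
    therefore exchanged on [p > e] only, where all is bounded, and [e = exp(-(N+1))] tends to 0: the
    boundary term at [e] is at most [e] times powers of [log e]. *)

(** * The modulus of a complex number as a real number *)

Section complex_modulus.
Context {R : realType}.
Implicit Types z w : Cplx R.

(** The norm of [Cplx R] takes its values in [Cplx R] itself; its real part is the modulus as an
    element of [R], where estimates are made. *)
Definition cmod (z : Cplx R) : R := complex.Re `|z|.

Lemma normE_cmod z : `|z| = RtoC (cmod z).
Proof. by []. Qed.

Lemma RtoC_le (x y : R) : (RtoC x <= RtoC y) = (x <= y).
Proof. by rewrite /RtoC lecR. Qed.

Lemma RtoC_lt (x y : R) : (RtoC x < RtoC y) = (x < y).
Proof. by rewrite /RtoC ltcR. Qed.

Lemma RtoCD (x y : R) : RtoC (x + y) = RtoC x + RtoC y.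
Proof. by rewrite /RtoC rmorphD. Qed.

Lemma RtoCM (x y : R) : RtoC (x * y) = RtoC x * RtoC y.
Proof. by rewrite /RtoC rmorphM. Qed.

Lemma RtoC_inj : injective (@RtoC R).
Proof. by move=> x y [->]. Qed.

Lemma cmod_ge0 z : 0 <= cmod z.
Proof. by rewrite -RtoC_le -normE_cmod normr_ge0. Qed.

Lemma cmod0 : cmod 0 = 0.
Proof. by rewrite /cmod normr0. Qed.

Lemma cmod_eq0 z : (cmod z == 0) = (z == 0).
Proof.
rewrite -[RHS]normr_eq0 normE_cmod.
by apply/eqP/eqP => [->|/RtoC_inj].
Qed.

Lemma cmodM z w : cmod (z * w) = cmod z * cmod w.
Proof. by apply: RtoC_inj; rewrite RtoCM -!normE_cmod normrM. Qed.

Lemma cmodD z w : cmod (z + w) <= cmod z + cmod w.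
Proof. by rewrite -RtoC_le RtoCD -!normE_cmod ler_normD. Qed.

Lemma cmodN z : cmod (- z) = cmod z.
Proof. by rewrite /cmod normrN. Qed.

Lemma cmodX z n : cmod (z ^+ n) = cmod z ^+ n.
Proof.
elim: n => [|n ih]; first by rewrite !expr0 /cmod normr1.
by rewrite !exprS cmodM ih.
Qed.

Lemma cmod_RtoC (x : R) : cmod (RtoC x) = `|x|.
Proof. by rewrite -sqrtr_sqr /cmod /= expr0n addr0. Qed.

Lemma cmod_nat n : cmod n%:R = n%:R.
Proof.
by apply: RtoC_inj; rewrite -normE_cmod normr_nat /RtoC rmorph_nat.
Qed.

Lemma cmod_sum (u : nat -> Cplx R) n :
  cmod (\sum_(0 <= i < n) u i) <= \sum_(0 <= i < n) cmod (u i).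
Proof.
elim: n => [|n ih]; first by rewrite !big_geq// cmod0.
by rewrite !big_nat_recr//=; apply: le_trans (cmodD _ _) _; rewrite lerD2r.
Qed.

Lemma Cplx_gt0 (e : Cplx R) : 0 < e -> exists2 d : R, 0 < d & e = RtoC d.
Proof.
move=> e0; exists (complex.Re e).
  by move: e0; rewrite ltcE => /andP[].
by move: e0; case: e => a b; rewrite ltcE /= => /andP[/eqP -> _].
Qed.

Lemma Re_le_cmod z : `|complex.Re z| <= cmod z.
Proof.
case: z => a b; rewrite /cmod /= -sqrtr_sqr ler_wsqrtr//.
by rewrite lerDl sqr_ge0.
Qed.

Lemma Im_le_cmod z : `|complex.Im z| <= cmod z.
Proof.
case: z => a b; rewrite /cmod /= -sqrtr_sqr ler_wsqrtr//.
by rewrite lerDr sqr_ge0.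
Qed.

Lemma cmod_le_ReIm z : cmod z <= `|complex.Re z| + `|complex.Im z|.
Proof.
have -> : z = RtoC (complex.Re z) + 'i%C * RtoC (complex.Im z).
  by rewrite /RtoC {1}[z]complexE.
apply: le_trans (cmodD _ _) _; rewrite cmodM !cmod_RtoC.
rewrite (_ : cmod 'i%C = 1) ?mul1r; last first.
  by rewrite /cmod /= expr0n expr1n add0r sqrtr1.
by rewrite /RtoC /=; case: z => a b /=; rewrite !(mul0r, mulr0, subr0, addr0, add0r, mul1r, mulr1).
Qed.

Lemma cvg_cmodP (u : nat -> Cplx R) (l : Cplx R) :
  (u @ \oo --> l) <-> (forall e : R, 0 < e -> \forall n \near \oo, cmod (u n - l) < e).
Proof.
split.
  move=> /cvgrPdist_lt h e e0.
  have /h : 0 < RtoC e :> Cplx R by rewrite -[0]/(RtoC 0) RtoC_lt.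
  apply: filterS => n; rewrite distrC normE_cmod RtoC_lt//.
move=> h; apply/cvgrPdist_lt => e /Cplx_gt0[d d0 ->].
apply: filterS (h _ d0) => n; by rewrite distrC normE_cmod RtoC_lt.
Qed.

End complex_modulus.

(** * Power series in the complex unit disk and their derivatives *)

Section complex_power_series.
Context {R : realType}.
Implicit Types (a b c : nat -> Cplx R) (z : Cplx R).

(** Radius of convergence at least 1, phrased so that it survives shifts and multiplication of the
    coefficients by [n], hence term-by-term differentiation; plain boundedness would not. *)
Definition disk_bounded a := forall r : R, 0 < r -> r < 1 ->
  exists C : R, forall n, cmod (a n) * r ^+ n <= C.

Definition psum_cvg a z (l : Cplx R) :=
  series (fun n => a n * z ^+ n) @ \oo --> l.

Lemma bernoulli_ge (x : R) n : 0 <= x -> 1 + n%:R * x <= (1 + x) ^+ n.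
Proof.
move=> x0; elim: n => [|n ih]; first by rewrite mul0r addr0 expr0.
rewrite exprS; apply: le_trans (ler_wpM2l _ ih); last lra.
rewrite mulrDl mul1r mulrDr mulr1 -natr1.
have : 0 <= x * (n%:R * x) by rewrite !mulr_ge0.
by lra.
Qed.

(** Bernoulli's inequality for [1/t = 1 + (1/t - 1)] gives [n (1/t - 1) <= t^-n]. *)
Lemma natrM_expr_bounded (t : R) : 0 < t -> t < 1 ->
  forall n, n%:R * t ^+ n <= (t^-1 - 1)^-1.
Proof.
move=> t0 t1 n; have d0 : 0 < t^-1 - 1 by rewrite subr_gt0 invf_gt1.
have := bernoulli_ge n (ltW d0); rewrite [1 + (_ - 1)]addrC subrK => h.
rewrite -(ler_pM2r d0) mulVf ?gt_eqF// mulrAC.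
have tn : 0 < t ^+ n by rewrite exprn_gt0.
have := ler_wpM2r (ltW tn) h; rewrite exprVn mulVf ?gt_eqF//.
by rewrite mulrDl mul1r; lra.
Qed.

(** The factor [n] is absorbed by powers of [r / s], for an intermediate radius [r < s < 1]. *)
Lemma disk_boundedMn a : disk_bounded a -> disk_bounded (fun n => n%:R * a n).
Proof.
move=> ha r r0 r1; set s := (r + 1) / 2.
have rs : r < s by rewrite /s; lra.
have s1 : s < 1 by rewrite /s; lra.
have s0 : 0 < s by lra.
have [C hC] := ha s s0 s1.
have t1 : r / s < 1 by rewrite ltr_pdivrMr// mul1r.
have t0 : 0 < r / s by rewrite divr_gt0.
exists (((r / s)^-1 - 1)^-1 * C) => n.
rewrite cmodM cmod_nat.
rewrite (_ : _ * _ * r ^+ n =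
  (n%:R * (r / s) ^+ n) * (cmod (a n) * s ^+ n)); last first.
  by rewrite -{1}(divfK (lt0r_neq0 s0) r)// exprMn; ring.
apply: ler_pM => //.
- by rewrite mulr_ge0// exprn_ge0// ltW.
- by rewrite mulr_ge0 ?cmod_ge0// exprn_ge0// ltW.
- exact: natrM_expr_bounded.
Qed.

Lemma disk_boundedS a : disk_bounded a -> disk_bounded (fun n => a n.+1).
Proof.
move=> ha r r0 r1; have [C hC] := ha r r0 r1; exists (C / r) => n.
by rewrite ler_pdivlMr// -mulrA -exprSr.
Qed.

Definition dcoef a n := n.+1%:R * a n.+1.

Lemma disk_bounded_dcoef a : disk_bounded a -> disk_bounded (dcoef a).
Proof. by move=> ha; apply/(@disk_boundedS (fun n => n%:R * a n))/disk_boundedMn. Qed.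

Lemma disk_bounded_le a (M : R) : (forall n, cmod (a n) <= M) -> disk_bounded a.
Proof.
move=> h r r0 r1; exists M => n; apply: le_trans (h n).
by rewrite ler_piMr ?cmod_ge0// exprn_ile1// ltW.
Qed.

(** Comparison with the geometric series of ratio [r / s], again for an intermediate radius [s]. *)
Lemma disk_bounded_sum a (r : R) : disk_bounded a -> 0 < r -> r < 1 ->
  exists B : R, forall m, \sum_(0 <= n < m) cmod (a n) * r ^+ n <= B.
Proof.
move=> ha r0 r1; set s := (r + 1) / 2.
have rs : r < s by rewrite /s; lra.
have s1 : s < 1 by rewrite /s; lra.
have s0 : 0 < s by lra.
have [C hC] := ha s s0 s1.
have C0 : 0 <= C.
  by apply: le_trans (hC 0%N); rewrite expr0 mulr1 cmod_ge0.
have t1 : r / s < 1 by rewrite ltr_pdivrMr// mul1r.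
have t0 : 0 < r / s by rewrite divr_gt0.
exists (C / (1 - r / s)) => m.
apply: (@le_trans _ _ (\sum_(0 <= n < m) C * (r / s) ^+ n)).
  apply: ler_sum => n _.
  rewrite (_ : _ * r ^+ n = (cmod (a n) * s ^+ n) * (r / s) ^+ n); last first.
    by rewrite -{1}(divfK (lt0r_neq0 s0) r)// exprMn; ring.
  by rewrite ler_wpM2r// exprn_ge0// ltW.
rewrite -big_distrr/= ler_wpM2l//.
rewrite -[leRHS]mul1r ler_pdivlMr ?subr_gt0//.
have : (1 - r / s) * (\sum_(0 <= n < m) (r / s) ^+ n) = 1 - (r / s) ^+ m.
  elim: m => [|m ih]; first by rewrite big_geq// mulr0 expr0 subrr.
  by rewrite big_nat_recr//= mulrDr ih exprS; ring.
rewrite mulrC => ->; rewrite gerBl exprn_ge0// ltW//.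
Qed.

Lemma cvg_cmod_le (u : nat -> Cplx R) (l : Cplx R) (B : R) :
  u @ \oo --> l -> (forall n, cmod (u n) <= B) -> cmod l <= B.
Proof.
move=> /cvg_cmodP ul uB; apply/ler_addgt0Pr => e e0.
have [n /= _ /(_ n (leqnn n)) hn] := ul _ e0.
rewrite (_ : l = u n - (u n - l)); last by rewrite opprB addrC subrK.
apply: le_trans (cmodD _ _) _; rewrite cmodN.
by apply: lerD (uB n) (ltW _).
Qed.

Lemma abs_bounded_series_cvg (u : nat -> Cplx R) (B : R) :
  (forall m, \sum_(0 <= n < m) cmod (u n) <= B) -> cvgn (series u).
Proof.
move=> uB.
have cN : cvgn (series (fun n => cmod (u n))).
  apply: nondecreasing_is_cvgn.
    by apply/nondecreasing_seqP => n; rewrite /series/= big_nat_recr//= lerDl cmod_ge0.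
  by exists B => _ [m _ <-]; exact: uB.
have cr : cvgn (series (fun n => complex.Re (u n))).
  apply: normed_cvg; apply: (series_le_cvg _ _ _ cN) => n /=; [by []|exact: cmod_ge0|exact: Re_le_cmod].
have ci : cvgn (series (fun n => complex.Im (u n))).
  apply: normed_cvg; apply: (series_le_cvg _ _ _ cN) => n /=; [by []|exact: cmod_ge0|exact: Im_le_cmod].
have sE n : series u n = (series (fun n => complex.Re (u n)) n
    +i* series (fun n => complex.Im (u n)) n)%C.
  rewrite /series/=; elim: n => [|n ih]; first by rewrite !big_geq.
  by rewrite !big_nat_recr//= ih; case: (u n).
apply/cvg_ex; exists (limn (series (fun n => complex.Re (u n)))
    +i* limn (series (fun n => complex.Im (u n))))%C.
apply/cvg_cmodP => e e0.
have e20 : 0 < e / 2 by lra.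
move/cvgrPdist_lt : cr => /(_ _ e20) cr.
move/cvgrPdist_lt : ci => /(_ _ e20) ci.
near=> n; rewrite sE.
apply: le_lt_trans (cmod_le_ReIm _) _ => /=.
rewrite (splitr e) ltrD// distrC.
  by near: n; exact: cr.
by near: n; exact: ci.
Unshelve. all: by end_near. Qed.

Lemma exists_between (x : R) : 0 <= x -> x < 1 -> exists r, [/\ 0 < r, x < r & r < 1].
Proof. by move=> x0 x1; exists ((x + 1) / 2); split; lra. Qed.

Lemma disk_bounded_cvg a z : disk_bounded a -> cmod z < 1 ->
  cvgn (series (fun n => a n * z ^+ n)).
Proof.
move=> ha z1; have [r [r0 zr r1]] := exists_between (cmod_ge0 z) z1.
have [B hB] := disk_bounded_sum ha r0 r1.
apply: (@abs_bounded_series_cvg _ B) => m; apply: le_trans (hB m).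
apply: ler_sum => n _; rewrite cmodM cmodX ler_wpM2l ?cmod_ge0//.
by rewrite lerXn2r ?nnegrE ?cmod_ge0// ltW.
Qed.

Lemma psum_cvg_lim a z : disk_bounded a -> cmod z < 1 ->
  psum_cvg a z (limn (series (fun n => a n * z ^+ n))).
Proof. by move=> ha z1; exact: disk_bounded_cvg. Qed.

(** The remainders satisfy [E_(n+1) = (z + h) E_n + n z^(n-1) h^2], and [n^2 + n <= (n+1)^2] closes
    the induction. The factor [r^2] on the left replaces an exponent [n - 2] on the right, which
    would be truncated for [n < 2]. *)
Lemma expr_remainder_le (z h : Cplx R) (r : R) n : 0 < r ->
  cmod z <= r -> cmod (z + h) <= r ->
  cmod ((z + h) ^+ n - z ^+ n - n%:R * z ^+ n.-1 * h) * r ^+ 2 <=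
  n%:R ^+ 2 * r ^+ n * cmod h ^+ 2.
Proof.
move=> r0 zr zhr; elim: n => [|n ih].
  by rewrite !expr0 subrr !mul0r subr0 cmod0 expr0n/= !mul0r.
rewrite (_ : _ - _ - _ = (z + h) * ((z + h) ^+ n - z ^+ n - n%:R * z ^+ n.-1 * h)
    + n%:R * z ^+ n.-1 * h ^+ 2); last first.
  case: n {ih} => [|n] /=; first by rewrite !expr0 !expr1; ring.
  by rewrite -[n.+2%:R]natr1 !exprS; ring.
apply: (@le_trans _ _ (r * (n%:R ^+ 2 * r ^+ n * cmod h ^+ 2)
    + n%:R * r ^+ n.+1 * cmod h ^+ 2)).
  apply: le_trans (ler_wpM2r _ (cmodD _ _)) _; first by rewrite exprn_ge0// ltW.
  rewrite mulrDl; apply: lerD.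
    rewrite cmodM -[cmod _ * _ * _]mulrA; apply: ler_pM; rewrite ?cmod_ge0//.
    by rewrite mulr_ge0 ?cmod_ge0// exprn_ge0// ltW.
  rewrite !cmodM !cmodX cmod_nat.
  case: n {ih} => [|n]; first by rewrite !mul0r.
  rewrite (_ : _ * r ^+ 2 = (n.+1%:R * cmod h ^+ 2) * (cmod z ^+ n * r ^+ 2)); last by ring.
  rewrite (_ : n.+1%:R * r ^+ n.+2 * _ = (n.+1%:R * cmod h ^+ 2) * (r ^+ n * r ^+ 2)); last first.
    by rewrite -[n.+2]addn2 exprD; ring.
  apply: ler_wpM2l; first by rewrite mulr_ge0// sqr_ge0.
  apply: ler_wpM2r; first exact: sqr_ge0.
  by rewrite lerXn2r ?nnegrE ?cmod_ge0// ltW.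
rewrite -natr1 !exprS.
have n0 : 0 <= n%:R :> R by [].
have p0 : 0 <= r * r ^+ n * cmod h ^+ 2 by rewrite !mulr_ge0 ?exprn_ge0 ?cmod_ge0 // ltW.
rewrite -subr_ge0 (_ : _ - _ = (n%:R + 1) * (r * r ^+ n * cmod h ^+ 2)); last by ring.
by rewrite mulr_ge0// addr_ge0.
Qed.

Lemma is_derive_quadratic (f : Cplx R -> Cplx R) z g (B d : R) : 0 < d ->
  (forall h, cmod h < d -> cmod (f (z + h) - f z - g * h) <= B * cmod h ^+ 2) ->
  is_derive z 1 f g.
Proof.
move=> d0 hf.
suff cv : (fun h : Cplx R => h^-1 *: (f (h *: 1 + z) - f z)) @ 0^' --> g.
  by apply: DeriveDef; [apply/cvg_ex; exists g|exact: cvg_lim].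
apply/cvgrPdist_lt => e /Cplx_gt0[e' e0 ->].
(* [B] may be negative or zero; [B'] is a positive majorant, by which [e'] can be divided. *)
pose B' := `|B| + 1; have B0 : 0 < B' by rewrite ltr_pwDr.
have dpos : 0 < Num.min d (e' / B') by rewrite lt_min d0 divr_gt0.
exists (RtoC (Num.min d (e' / B'))).
  by rewrite /= -[0]/(RtoC 0) RtoC_lt.
move=> h /=; rewrite sub0r normrN normE_cmod RtoC_lt lt_min => /andP[hd he] h0.
rewrite -[h *: 1]/(h * 1) mulr1 normE_cmod RtoC_lt.
have ch0 : 0 < cmod h by rewrite lt_neqAle cmod_ge0 eq_sym cmod_eq0 h0.
rewrite -(ltr_pM2r ch0) -cmodM.
rewrite -[h^-1 *: _]/(h^-1 * _) mulrBl mulrAC mulVf// mul1r -cmodN opprB.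
rewrite (addrC h z); apply: le_lt_trans (hf _ hd) _.
rewrite expr2 mulrA ltr_pM2r//; move: he; rewrite ltr_pdivlMr// mulrC => he.
apply: le_lt_trans he; rewrite ler_pM2r// /B'.
by rewrite (le_trans (ler_norm _))// lerDl.
Qed.

(** The bound is kept apart from [is_derive] because it is used again for the second derivative:
    there the function is [derive1 f], which agrees with its series only inside the disk, so the
    fact that [z + h] stays in the disk is part of the conclusion. *)
Lemma psum_derive_bound a z (f g : Cplx R -> Cplx R) : disk_bounded a ->
  (forall x, cmod x < 1 -> psum_cvg a x (f x)) ->
  (forall x, cmod x < 1 -> psum_cvg (dcoef a) x (g x)) ->
  cmod z < 1 -> exists B d : R, 0 < d /\
    forall h, cmod h < d -> cmod (z + h) < 1 /\
     cmod (f (z + h) - f z - g z * h) <= B * cmod h ^+ 2.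
Proof.
move=> ha hf hg z1; have [r [r0 zr r1]] := exists_between (cmod_ge0 z) z1.
have [B hB] := disk_bounded_sum (disk_boundedMn (disk_boundedMn ha)) r0 r1.
exists (B / r ^+ 2), (r - cmod z); split; first by rewrite subr_gt0.
move=> h hd.
have zhr : cmod (z + h) < r.
  by apply: le_lt_trans (cmodD _ _) _; lra.
have zh1 : cmod (z + h) < 1 by lra.
split => //.
(* The series of [f] is cut one term later than that of [g], so that both partial sums use the
   coefficients up to [a m]. *)
apply: (@cvg_cmod_le (fun m => series (fun n => a n * (z + h) ^+ n) m.+1
   - series (fun n => a n * z ^+ n) m.+1 - series (fun n => dcoef a n * z ^+ n) m * h)).
  apply: cvgB; first apply: cvgB.
  - by rewrite (cvg_shiftS (series _)); exact: hf.
  - by rewrite (cvg_shiftS (series _)); exact: hf.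
  - by apply: cvgMl; exact: hg.
move=> m.
have -> : series (fun n => dcoef a n * z ^+ n) m =
    series (fun n => n%:R * a n * z ^+ n.-1) m.+1.
  by rewrite /series/= [RHS]big_nat_recl//= !mul0r add0r.
rewrite /series/= mulr_suml -!sumrB.
apply: le_trans (cmod_sum _ _) _.
rewrite mulrAC ler_pdivlMr ?exprn_gt0// mulr_suml.
apply: (le_trans _ (ler_wpM2r (sqr_ge0 _) (hB m.+1))).
rewrite mulr_suml; apply: ler_sum => n _.
rewrite (_ : _ - _ - _ = a n * ((z + h) ^+ n - z ^+ n - n%:R * z ^+ n.-1 * h)); last by ring.
rewrite cmodM -[cmod _ * _ * _]mulrA.
apply: le_trans (ler_wpM2l (cmod_ge0 _) (expr_remainder_le n r0 (ltW zr) (ltW zhr))) _.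
by rewrite !cmodM !cmod_nat le_eqVlt; apply/orP; left; apply/eqP; ring.
Qed.

Lemma psum_is_derive a z (f g : Cplx R -> Cplx R) : disk_bounded a ->
  (forall x, cmod x < 1 -> psum_cvg a x (f x)) ->
  (forall x, cmod x < 1 -> psum_cvg (dcoef a) x (g x)) ->
  cmod z < 1 -> is_derive z 1 f (g z).
Proof.
move=> ha hf hg z1; have [B [d [d0 hd]]] := psum_derive_bound ha hf hg z1.
by apply: (@is_derive_quadratic f z (g z) B d d0) => h /hd[].
Qed.

Lemma psum_cvgD a b z l l' : psum_cvg a z l -> psum_cvg b z l' ->
  psum_cvg (fun n => a n + b n) z (l + l').
Proof.
move=> ha hb; rewrite /psum_cvg.
rewrite (_ : series _ = (fun m => series (fun n => a n * z ^+ n) m + series (fun n => b n * z ^+ n) m)).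
  exact: (cvgD ha hb).
by apply/funext => n; rewrite /series/= -big_split/=; apply: eq_bigr => i _; rewrite mulrDl.
Qed.

Lemma psum_cvgZ (k : Cplx R) a z l : psum_cvg a z l ->
  psum_cvg (fun n => k * a n) z (k * l).
Proof.
move=> ha; rewrite /psum_cvg.
rewrite (_ : series _ = (fun n => k * series (fun n => a n * z ^+ n) n)).
  by apply: cvgMr; exact: ha.
by apply/funext => n; rewrite /series/= mulr_sumr; apply: eq_bigr => i _; rewrite mulrA.
Qed.

(** The coefficients of [z] times the series of [a]. *)
Definition scoef a n : Cplx R := if n is m.+1 then a m else 0.

Lemma psum_cvgS a z l : psum_cvg a z l -> psum_cvg (scoef a) z (z * l).
Proof.
move=> ha; rewrite /psum_cvg -(cvg_shiftS (series _)).
rewrite (_ : (fun n => _) = (fun n => z * series (fun n => a n * z ^+ n) n)).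
  by apply: cvgMr; exact: ha.
apply/funext => n; rewrite /series/= big_nat_recl//= mul0r add0r mulr_sumr.
by apply: eq_bigr => i _; rewrite exprS; ring.
Qed.

End complex_power_series.

(** * From the recurrence on coefficients to the differential equation *)

Section recurrence_to_ode.
Context {R : realType}.

Lemma derive1_is_derive (f : Cplx R -> Cplx R) (z g : Cplx R) :
  is_derive z 1 f g -> derive1 f z = g.
Proof. by move=> h; rewrite derive1E; exact: derive_val. Qed.

(** In the coefficient of [z^n], the terms [z f'' + f'] give [(n+1)^2], the terms
    [-2 z^2 f'' - 4 z f' - 3/4 f] give [-(2n^2 + 2n + 3/4)], and [z^3 f'' + 3 z^2 f' + z f] give
    [n^2]. *)
Lemma recurrence_ode (a b : nat -> R) (M : R) (z : Cplx R) :
  (forall n, `|a n| <= M) ->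
  (forall n, n.+1%:R ^+ 2 * a n.+1 - (2 * n%:R ^+ 2 + 2 * n%:R + 3 / 4) * a n
     + n%:R ^+ 2 * a n.-1 = b n) ->
  `|z| < 1 ->
  let f := fun x : Cplx R => limn (series (fun n => RtoC (a n) * x ^+ n)) in
  let g := fun x : Cplx R => limn (series (fun n => RtoC (b n) * x ^+ n)) in
  [/\ cvgn (series (fun n => RtoC (a n) * z ^+ n)),
      cvgn (series (fun n => RtoC (b n) * z ^+ n)),
      derivable f z 1,
      derivable (derive1 f) z 1 &
      z * (1 - z) ^+ 2 * derive1 (derive1 f) z
        + (1 - z) * (1 - 3 * z) * derive1 f z + (z - 3 / 4) * f z = g z].
Proof.
move=> aM rec; rewrite normE_cmod -[1]/(RtoC 1) RtoC_lt => z1 f g.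
pose c0 n : Cplx R := RtoC (a n).
have d0 : disk_bounded c0.
  by apply: (@disk_bounded_le _ _ M) => n; rewrite cmod_RtoC.
pose c1 := dcoef c0; pose c2 := dcoef c1.
have d1 : disk_bounded c1 by exact: disk_bounded_dcoef.
have d2 : disk_bounded c2 by exact: disk_bounded_dcoef.
pose f1 (x : Cplx R) : Cplx R := limn (series (fun n => c1 n * x ^+ n)).
pose f2 (x : Cplx R) : Cplx R := limn (series (fun n => c2 n * x ^+ n)).
have h0 x : cmod x < 1 -> psum_cvg c0 x (f x) by exact: psum_cvg_lim.
have h1 x : cmod x < 1 -> psum_cvg c1 x (f1 x) by exact: psum_cvg_lim.
have h2 x : cmod x < 1 -> psum_cvg c2 x (f2 x) by exact: psum_cvg_lim.
have D0 x : cmod x < 1 -> is_derive x 1 f (f1 x).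
  by move=> x1; exact: (psum_is_derive d0 h0 h1 x1).
have E0 x : cmod x < 1 -> derive1 f x = f1 x.
  by move=> x1; exact/derive1_is_derive/D0.
have D1 : is_derive z 1 (derive1 f) (f2 z).
  have [B [d [dpos hd]]] := psum_derive_bound d1 h1 h2 z1.
  apply: (@is_derive_quadratic _ _ _ _ B d dpos) => h /hd[zh1].
  by rewrite !E0.
have E1 := derive1_is_derive D1.
have hb : psum_cvg (fun n => RtoC (b n)) z
    (z * (1 - z) ^+ 2 * f2 z + (1 - z) * (1 - 3 * z) * f1 z + (z - 3 / 4) * f z).
  have s0 := h0 _ z1; have s1 := h1 _ z1; have s2 := h2 _ z1.
  have := psum_cvgS s2 => t1; have := psum_cvgS t1 => t2.
  have := psum_cvgS t2 => t3; have := psum_cvgS s1 => u1.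
  have := psum_cvgS u1 => u2; have := psum_cvgS s0 => v1.
  have -> : z * (1 - z) ^+ 2 * f2 z + (1 - z) * (1 - 3 * z) * f1 z + (z - 3 / 4) * f z =
     z * f2 z + -2 * (z * (z * f2 z)) + z * (z * (z * f2 z)) +
     f1 z + -4 * (z * f1 z) + 3 * (z * (z * f1 z)) + z * f z + - (3 / 4) * f z.
    move: (f z) (f1 z) (f2 z) => F0 F1 F2.
    by field.
  have -> : (fun n => RtoC (b n)) = (fun n => scoef c2 n + -2 * scoef (scoef c2) n
     + scoef (scoef (scoef c2)) n + c1 n + -4 * scoef c1 n + 3 * scoef (scoef c1) n
     + scoef c0 n + - (3 / 4) * c0 n); last first.
    exact: (psum_cvgD (psum_cvgD (psum_cvgD (psum_cvgD (psum_cvgD (psum_cvgD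
     (psum_cvgD t1 (@psum_cvgZ _ (-2) _ _ _ t2)) t3) s1) (@psum_cvgZ _ (-4) _ _ _ u1))
     (@psum_cvgZ _ 3 _ _ _ u2)) v1) (@psum_cvgZ _ (- (3 / 4)) _ _ _ s0)).
  apply/funext => n; rewrite -rec {rec}.
  have RtoCn m : RtoC m%:R = m%:R :> Cplx R by rewrite /RtoC rmorph_nat.
  have RtoCV m : RtoC m^-1 = (RtoC m)^-1 :> Cplx R by rewrite /RtoC fmorphV.
  have RtoCN m : RtoC (- m) = - RtoC m :> Cplx R by rewrite /RtoC rmorphN.
  rewrite !RtoCD RtoCN !RtoCM !RtoCD !RtoCM !RtoCn RtoCV RtoCn.
  (* Up to three shifts pad with zeros, so the first three coefficients are treated apart; at
     [n = 0] the value [a n.-1 = a 0] is cancelled by [n^2 = 0]. *)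
  case: n => [|[|[|n]]]; rewrite /scoef /c2 /c1 /dcoef /c0 /=.
  - by field.
  - by field.
  - by field.
  - rewrite -![in n.+4%:R]natr1 -![in n.+3%:R]natr1 -![in n.+2%:R]natr1 -![in n.+1%:R]natr1.
    by field.
split.
- exact: disk_bounded_cvg d0 z1.
- by apply/cvg_ex; eexists; exact: hb.
- exact: (@ex_derive _ _ _ _ _ _ _ (D0 _ z1)).
- exact: (@ex_derive _ _ _ _ _ _ _ D1).
- by rewrite E1 (E0 _ z1); apply/esym/cvg_lim => //; exact: hb.
Qed.

End recurrence_to_ode.

(* The library rules derive [f + g], [f ^+ n], ... in the ring of functions; the
   following variants act on explicit lambda-abstractions. *)
Section pointwise_derivation.
Context {R : realType}.
Implicit Types (f g : R -> R) (x : R).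

Definition hasder f x (d : R) := is_derive (x : R^o) 1 (f : R^o -> R^o) d.

Lemma hasder_eq f x d d' : hasder f x d -> d = d' -> hasder f x d'.
Proof. by move=> h <-. Qed.

Lemma hasder_cst c x : hasder (fun=> c) x 0.
Proof. exact: is_derive_cst. Qed.

Lemma hasder_id x : hasder (fun y => y) x 1.
Proof. exact: is_derive_id. Qed.

Lemma hasderN f x d : hasder f x d -> hasder (fun y => - f y) x (- d).
Proof. by move=> h; exact: is_deriveN. Qed.

Lemma hasderD f g x d e : hasder f x d -> hasder g x e ->
  hasder (fun y => f y + g y) x (d + e).
Proof. by move=> h k; exact: is_deriveD. Qed.

Lemma hasderB f g x d e : hasder f x d -> hasder g x e ->
  hasder (fun y => f y - g y) x (d - e).
Proof. by move=> h k; exact/hasderD/hasderN. Qed.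

Lemma hasderM f g x d e : hasder f x d -> hasder g x e ->
  hasder (fun y => f y * g y) x (d * g x + f x * e).
Proof.
move=> h k; apply: is_derive_eq (is_deriveM h k) _.
by rewrite /GRing.scale/=; ring.
Qed.

Lemma hasderX f x d n : hasder f x d ->
  hasder (fun y => f y ^+ n) x (n%:R * f x ^+ n.-1 * d).
Proof.
move=> h; elim: n => [|[|n] ih].
- by rewrite !mul0r; exact: hasder_cst.
- by apply: hasder_eq h _; rewrite expr0 !mul1r.
- apply: hasder_eq (hasderM h ih) _ => /=.
  by rewrite -[n.+2%:R]natr1 !exprS; ring.
Qed.

Lemma hasderV f x d : f x != 0 -> hasder f x d ->
  hasder (fun y => (f y)^-1) x (- d / f x ^+ 2).
Proof.
move=> f0 h; apply: is_derive_eq (is_deriveV f0 h) _.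
by rewrite /GRing.scale/=; ring.
Qed.

Lemma hasder_ln x : 0 < x -> hasder (@ln R) x x^-1.
Proof. by move=> x0; exact: is_derive1_ln. Qed.

Lemma hasder_sqrt f x d : 0 < f x -> hasder f x d ->
  hasder (fun y => Num.sqrt (f y)) x (d / (2 * Num.sqrt (f x))).
Proof.
move=> f0 h; have := is_derive1_sqrt f0 => s.
by apply: is_derive_eq (is_derive1_comp s h) _; rewrite mulrC.
Qed.

Lemma hasder_continuous f x d : hasder f x d -> {for x, continuous f}.
Proof.
by move=> h; apply/differentiable_continuous/derivable1_diffP/(@ex_derive _ _ _ _ _ _ _ h).
Qed.

Lemma hasder_derive1 f x d : hasder f x d -> (f^`())%classic x = d.
Proof. by move=> h; rewrite derive1E; exact: derive_val. Qed.

Lemma hasder_FTC (f F : R -> R) (a b : R) : a < b ->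
  {in `[a, b], continuous f} ->
  (forall x, a <= x <= b -> hasder F x (f x)) ->
  (\int[lebesgue_measure]_(x in `[a, b]) (f x)%:E)%E = (F b - F a)%:E.
Proof.
move=> ab cf dF; rewrite (@continuous_FTC2 _ f F)//.
- by apply: continuous_in_subspaceT => x /set_mem; exact: cf.
- split.
  + move=> x; rewrite in_itv/= => /andP[/ltW ax /ltW xb].
    by apply: (@ex_derive _ _ _ _ _ _ _ (dF x _)); rewrite ax.
  + by apply/cvg_at_right_filter/(@hasder_continuous _ _ (f a))/dF; rewrite lexx ltW.
  + by apply/cvg_at_left_filter/(@hasder_continuous _ _ (f b))/dF; rewrite lexx ltW.
- move=> x; rewrite in_itv/= => /andP[/ltW ax /ltW xb].
  by apply/hasder_derive1/dF; rewrite ax.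
Qed.

End pointwise_derivation.

(** * Tonelli's theorem on a region fibred in two ways *)

Section tonelli_region.
Local Open Scope ereal_scope.
Context d1 d2 (T1 : measurableType d1) (T2 : measurableType d2) (R : realType).
Variables (m1 : {sigma_finite_measure set T1 -> \bar R}).
Variables (m2 : {sigma_finite_measure set T2 -> \bar R}).
Variables (A1 : set T1) (B1 : T1 -> set T2) (A2 : set T2) (B2 : T2 -> set T1).
Variables (f : T1 * T2 -> \bar R).
Hypothesis mf : measurable_fun [set: T1 * T2] f.
Hypothesis f0 : forall z, 0 <= f z.
Let C := [set z | A1 z.1 /\ B1 z.1 z.2].
Hypothesis mC : measurable C.

Let mfC : measurable_fun setT (f \_ C).
Proof. by apply/(measurable_restrictT f mC); exact: measurable_funTS. Qed.

Let fC0 z : 0 <= (f \_ C) z.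
Proof. exact: erestrict_ge0. Qed.

Let integral_regionE :
  (fun x => \int[m2]_(y in B1 x) f (x, y)) \_ A1 = fubini_F m2 (f \_ C).
Proof.
apply/funext => x; rewrite /fubini_F patchE; case: ifPn => [/set_mem Ax|/negP Ax].
  rewrite [LHS]integral_mkcond; apply: eq_integral => y _.
  rewrite !patchE; case: ifPn => [/set_mem By|/negP By]; first by rewrite mem_set.
  by rewrite memNset// => -[_ /= /mem_set].
rewrite integral0_eq// => y _; rewrite patchE memNset//= => -[/= /mem_set].
by [].
Qed.

Lemma measurable_integral_region : measurable A1 ->
  measurable_fun A1 (fun x => \int[m2]_(y in B1 x) f (x, y)).
Proof.
move=> mA1; apply/(measurable_restrictT _ mA1).
by rewrite integral_regionE; exact: measurable_fun_fubini_tonelli_F.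
Qed.

(** Both sides are iterated integrals of [f \_ C] over the whole product; the hypothesis says that
    the two families of fibres cut out the same set. *)
Lemma tonelli_region : (forall x y, (A1 x /\ B1 x y) <-> (A2 y /\ B2 y x)) ->
  \int[m1]_(x in A1) \int[m2]_(y in B1 x) f (x, y) =
  \int[m2]_(y in A2) \int[m1]_(x in B2 y) f (x, y).
Proof.
move=> AB; rewrite [LHS]integral_mkcond [RHS]integral_mkcond integral_regionE.
rewrite fubini_tonelli//; apply: eq_integral => y _.
rewrite patchE; case: ifPn => [/set_mem Ay|/negP Ay].
  rewrite [RHS]integral_mkcond; apply: eq_integral => x _.
  rewrite !patchE; case: ifPn => [/set_mem/= /AB[_ Bx]|/negP By].
    by rewrite mem_set.
  by rewrite memNset// => Bx; apply/By/mem_set/AB.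
rewrite integral0_eq// => x _; rewrite patchE memNset//= => /AB[/mem_set].
by [].
Qed.

Lemma integral_prod_region : \int[m1 \x m2]_(z in C) f z =
  \int[m1]_(x in A1) \int[m2]_(y in B1 x) f (x, y).
Proof.
by rewrite [LHS]integral_mkcond [RHS]integral_mkcond integral_regionE fubini_tonelli1.
Qed.

End tonelli_region.

(** * Measurability of the inverse and of the square root *)

Section real_measurability.
Context {R : realType}.

Lemma measurable_inv : measurable_fun setT (fun x : R => x^-1).
Proof.
have -> : [set: R] = [set 0] `|` ~` [set 0] by rewrite setUv.
apply/measurable_funU => //; first exact: measurableC.
split; first exact: measurable_fun_set1.
apply: open_continuous_measurable_fun.
  by rewrite openC; exact: closed_eq.
by move=> x; rewrite inE /= => /eqP x0; exact: inv_continuous.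
Qed.

Lemma measurable_funV d (T : measurableType d) (f : T -> R) :
  measurable_fun setT f -> measurable_fun setT (fun x => (f x)^-1).
Proof. by move=> mf; exact: (measurableT_comp measurable_inv). Qed.

Lemma measurable_sqrt : measurable_fun setT (@Num.sqrt R).
Proof. by apply: continuous_measurable_fun; exact: sqrt_continuous. Qed.

End real_measurability.

(** * Dilations and Lebesgue measure *)

Section scaling.
Local Open Scope ereal_scope.
Context {R : realType}.
Let mu := @lebesgue_measure R.

Lemma measurable_mulr (c : R) :
  measurable_fun setT ((fun x => x * c)%R : measurableTypeR R -> measurableTypeR R).
Proof. exact: mulrr_measurable. Qed.

(** The right-hand side is a measure with the right values on half-open intervals, and Lebesgue
    measure is the only such one. *)
Lemma lebesgue_measure_scale (c : R) (c0 : (0 < c)%R) (A : set R) : measurable A ->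
  mu A = c%:E * mu ((fun x => x * c)%R @^-1` A).
Proof.
move=> mA.
have c0' : (0 <= c)%R by exact: ltW.
rewrite -[RHS]/(pushforward (mscale (NngNum c0') mu)
  ((fun x => x * c)%R : measurableTypeR R -> measurableTypeR R) A).
apply: lebesgue_measure_unique => //=; first exact: measurable_mulr.
move=> mphi _ [[a b]] _ <-.
rewrite /pushforward /mscale/=.
rewrite (_ : _ @^-1` _ = `](a / c)%R, (b / c)%R]%classic); last first.
  by apply/seteqP; split => x /=; rewrite !in_itv/= ltr_pdivrMr// ler_pdivlMr.
rewrite /mu !lebesgue_measure_itv/= !lte_fin ltr_pM2r ?invr_gt0//.
by case: ifPn => _; rewrite ?mule0// -!EFinB -EFinM; congr EFin; field; rewrite gt_eqF.
Qed.

Lemma integral_scale (c : R) (f : R -> \bar R) : (0 < c)%R ->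
  measurable_fun [set: R] f -> (forall x, 0 <= f x) ->
  \int[mu]_(x in `]0%R, c[) f x = c%:E * \int[mu]_(x in `]0%R, 1%R[) f (x * c)%R.
Proof.
move=> c0 mf f0; have c0' : (0 <= c)%R by exact: ltW.
have -> : `]0%R, 1%R[%classic = (fun x => x * c)%R @^-1` `]0%R, c[ :> set R.
  by apply/seteqP; split => x /=; rewrite !in_itv/= pmulr_lgt0// gtr_pMl.
rewrite -[c in RHS]/((NngNum c0')%:num)%R.
have mphi := measurable_mulr c.
have mD : measurable ((fun x => x * c)%R @^-1` `]0%R, c[ : set (measurableTypeR R)).
  by rewrite -[X in measurable X]setTI; exact: mphi.
rewrite -(@ge0_integral_mscale _ _ _ mu _ mD (NngNum c0') (fun x => f (x * c)%R))//; last first.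
  by apply: measurable_funTS; exact: measurableT_comp.
rewrite -(ge0_integral_pushforward mphi (mscale (NngNum c0') mu))//=.
  by apply: eq_measure_integral => A mA _; exact: lebesgue_measure_scale.
exact: measurable_funTS.
Qed.

End scaling.

(** * Logarithmic densities of products of uniform variables *)

Section log_weights.
Local Open Scope ereal_scope.
Context {R : realType}.
Let mu := @lebesgue_measure R.
Notation I01 := (`]0%R, 1%R[%classic : set R).

Lemma measurable_lt_set d (T : measurableType d) (f g : T -> R) :
  measurable_fun [set: T] f -> measurable_fun [set: T] g ->
  measurable [set z | f z < g z]%R.
Proof.
move=> mf mg; have := measurable_fun_ltr mf mg => /(_ measurableT [set true]).
by rewrite setTI; exact.
Qed.

Lemma measurable_triangle :
  measurable [set z : R * R | I01 z.1 /\ (`]0%R, z.1[%classic : set R) z.2].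
Proof.
rewrite (_ : mkset _ = [set z | (0 < z.2)%R] `&` [set z | (z.2 < z.1)%R] `&`
    [set z | (z.1 < 1)%R]).
  by apply: measurableI; [apply: measurableI|]; apply: measurable_lt_set.
apply/seteqP; split=> [[x y]|[x y]] /=; rewrite !in_itv/=.
  by move=> [/andP[? ?] /andP[? ?]]; repeat split.
by move=> [[y0 yx] x1]; rewrite y0 yx x1 (lt_trans y0 yx).
Qed.

Lemma measurable_invnorm : measurable_fun [set: R] (fun y : R => (`|y|^-1)%:E).
Proof. by apply/measurable_EFinP/measurable_funV; exact: normr_measurable. Qed.

(** At fixed [y] put [p = x y], so that [dx = dp / y], then exchange the integrals over
    [0 < p < y < 1]. The absolute value makes the new integrand nonnegative on the whole plane, as
    [tonelli_region] requires. *)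
Lemma integral_mul_subst (Phi : R * R -> \bar R) :
  measurable_fun [set: R * R] Phi -> (forall z, 0 <= Phi z) ->
  \int[mu]_(y in I01) \int[mu]_(x in I01) Phi (y, x * y)%R =
  \int[mu]_(p in I01) \int[mu]_(y in `]p, 1%R[) ((`|y|^-1)%:E * Phi (y, p)).
Proof.
move=> mPhi Phi0.
transitivity (\int[mu]_(y in I01) \int[mu]_(p in `]0%R, y[) ((`|y|^-1)%:E * Phi (y, p))).
  apply: eq_integral => y /set_mem /=; rewrite in_itv/= => /andP[y0 y1].
  rewrite ge0_integralZl//; last first.
    by apply: measurable_funTS; exact: measurableT_comp.
  rewrite (integral_scale y0)//; last exact: measurableT_comp.
  by rewrite gtr0_norm// muleA -EFinM mulVf ?gt_eqF// mul1e.
apply: (@tonelli_region _ _ (measurableTypeR R) (measurableTypeR R) R mu mu I01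
  (fun y => `]0%R, y[%classic) I01 (fun p => `]p, 1%R[%classic)
  (fun z => (`|z.1|^-1)%:E * Phi z)).
- apply: emeasurable_funM => //.
  apply/measurable_EFinP/measurable_funV; apply: measurableT_comp => //.
- by move=> z; rewrite mule_ge0// lee_fin invr_ge0.
- exact: measurable_triangle.
- move=> y p /=; rewrite !in_itv/=; split.
    by move=> [/andP[y0 y1] /andP[p0 py]]; rewrite p0 py y1 (lt_trans py y1).
  by move=> [/andP[p0 p1] /andP[py y1]]; rewrite p0 py y1 (lt_trans p0 py).
Qed.

(** On []0, 1[], the density of a product of [m + 1] independent uniform variables. The absolute
    value keeps it nonnegative on the whole line. *)
Definition lnpow m (x : R) : R := `|ln x| ^+ m / m`!%:R.

Lemma lnpow_ge0 m x : (0 <= lnpow m x)%R.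
Proof. by rewrite /lnpow divr_ge0// exprn_ge0. Qed.

Lemma measurable_lnpow m : measurable_fun [set: R] (lnpow m).
Proof.
apply: measurable_funM => //; apply: measurable_funX.
by apply: measurableT_comp => //; exact: measurable_ln.
Qed.

Lemma lnpowE m x : (0 < x)%R -> (x <= 1)%R -> lnpow m x = ((- ln x) ^+ m / m`!%:R)%R.
Proof. by move=> x0 x1; rewrite /lnpow ler0_norm// ln_le0. Qed.

Lemma lnpow0 x : lnpow 0 x = 1%R.
Proof. by rewrite /lnpow expr0 fact0 divr1. Qed.

Lemma hasder_nlnpow m (x : R) : (0 < x)%R ->
  hasder (fun y => (- ln y) ^+ m.+1 / m.+1`!%:R)%R x (- ((- ln x) ^+ m / m`!%:R / x))%R.
Proof.
move=> x0.
apply: hasder_eq (hasderM (hasderX m.+1 (hasderN (hasder_ln x0))) (hasder_cst _ _)) _.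
have m0 : (m`!%:R != 0 :> R)%R by rewrite pnatr_eq0 -lt0n fact_gt0.
rewrite factS natrM/=.
by field; rewrite m0 gt_eqF//= addrC natr1 pnatr_eq0.
Qed.

Lemma integral_lnpow_div m (p : R) : (0 < p)%R -> (p < 1)%R ->
  \int[mu]_(y in `]p, 1%R[) ((`|y|^-1)%:E * (lnpow m y)%:E) = (lnpow m.+1 p)%:E.
Proof.
move=> p0 p1.
rewrite -(@integral_itv_bndoo _ p 1 _ true false); last first.
  apply: measurable_funTS; apply: emeasurable_funM.
    exact: measurable_invnorm.
  by apply/measurable_EFinP; exact: measurable_lnpow.
transitivity (\int[mu]_(y in `[p, 1%R]) ((- ln y) ^+ m / m`!%:R / y)%:E).
  apply: eq_integral => y /set_mem /=; rewrite in_itv/= => /andP[py y1].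
  have y0 : (0 < y)%R by exact: lt_le_trans p0 py.
  by rewrite lnpowE// gtr0_norm// -EFinM mulrC.
rewrite (@hasder_FTC _ _ (fun y => - ((- ln y) ^+ m.+1 / m.+1`!%:R))%R)//.
- by rewrite ln1 oppr0 expr0n/= mul0r oppr0 sub0r opprK lnpowE// ltW.
- move=> y; rewrite in_itv/= => /andP[py _].
  have y0 : (0 < y)%R by exact: lt_le_trans p0 py.
  apply: hasder_continuous.
  exact: hasderM (hasderM (hasderX m (hasderN (hasder_ln y0))) (hasder_cst _ _))
    (hasderV (lt0r_neq0 y0) (hasder_id _)).
- move=> y /andP[py _].
  apply: hasder_eq (hasderN (hasder_nlnpow m (lt_le_trans p0 py))) _.
  by rewrite opprK.
Qed.

Lemma measurable_mul2 : measurable_fun [set: R * R] (fun z => z.1 * z.2)%R.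
Proof. exact: measurable_funM. Qed.

(** Multiplying by one more uniform variable raises the index of the density by one. *)
Lemma integral_lnpowS m (h : R -> \bar R) :
  measurable_fun [set: R] h -> (forall x, 0 <= h x) ->
  \int[mu]_(z in I01) \int[mu]_(x in I01) (h (z * x)%R * (lnpow m x)%:E) =
  \int[mu]_(p in I01) (h p * (lnpow m.+1 p)%:E).
Proof.
move=> mh h0.
have l0 k x : 0 <= (lnpow k x)%:E :> \bar R by rewrite lee_fin lnpow_ge0.
have ml k : measurable_fun [set: R] (EFin \o lnpow k).
  by apply/measurable_EFinP; exact: measurable_lnpow.
(* The variable carrying [lnpow] becomes the outer one, in the role of [y] in [integral_mul_subst];
   what remains inside is the integral of [lnpow m y / y]. *)
rewrite (@tonelli_region _ _ (measurableTypeR R) (measurableTypeR R) R mu mu I01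
  (fun=> I01) I01 (fun=> I01) (fun z => h (z.1 * z.2)%R * (lnpow m z.2)%:E))/=; last 4 first.
- apply: emeasurable_funM.
    by apply: (measurableT_comp mh); exact: measurable_mul2.
  exact: (measurableT_comp (ml m)).
- by move=> z; rewrite mule_ge0.
- by apply: (@measurableX _ _ (measurableTypeR R) (measurableTypeR R) I01 I01).
- by move=> x y; split => -[].
rewrite (@integral_mul_subst (fun z => h z.2 * (lnpow m z.1)%:E)); last 2 first.
- apply: emeasurable_funM.
    exact: (measurableT_comp mh).
  exact: (measurableT_comp (ml m)).
- by move=> z; rewrite mule_ge0.
apply: eq_integral => p /set_mem/=; rewrite in_itv/= => /andP[p0 p1].
rewrite -(integral_lnpow_div m p0 p1) -ge0_integralZl//.
- by apply: eq_integral => y _; rewrite muleCA.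
- by apply: measurable_funTS; apply: emeasurable_funM; [exact: measurable_invnorm|exact: ml].
- by move=> y _; rewrite mule_ge0// lee_fin invr_ge0.
Qed.

Lemma integral_lnpow m : \int[mu]_(p in I01) (lnpow m p)%:E = 1.
Proof.
elim: m => [|m ih].
  under eq_integral do rewrite lnpow0.
  by rewrite integral_cst//= mul1e /mu lebesgue_measure_itv/= lte01 oppr0 adde0.
have := @integral_lnpowS m (cst 1) (measurable_cst _) (fun=> lee01).
under [in X in X -> _]eq_integral do under eq_integral do rewrite mul1e.
under [in X in _ = X -> _]eq_integral do rewrite mul1e.
move=> <-; under eq_integral do rewrite ih.
by rewrite integral_cst//= mul1e /mu lebesgue_measure_itv/= lte01 oppr0 adde0.
Qed.

End log_weights.

(** * Integrals over the cube of functions of partial products *)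

Section cube_integrals.
Local Open Scope ereal_scope.
Context {R : realType}.
Let mu := @lebesgue_measure R.
Notation I01 := (`]0%R, 1%R[%classic : set R).
Notation cube := (unit_cube R).
Notation leb := (lebesgue_tuple R).

Lemma measurable_unit_cube k : measurable (cube k).
Proof.
rewrite (_ : cube k = \bigcap_(i in [set: 'I_k])
    ((fun u : tupleR k R => tnth u i) @^-1` `[0%R, 1%R]%classic)).
  apply: fin_bigcap_measurable => // i _.
  rewrite -[X in measurable X]setTI.
  have := @measurable_tnth _ (measurableTypeR R) k i.
  by move=> /(_ measurableT); apply; exact: measurable_itv.
by apply/seteqP; split => u h i => [_|]; have := h i; rewrite /= in_itv//=; apply.
Qed.

Lemma measurable_prod_tnth k (P : pred 'I_k) :
  measurable_fun [set: tupleR k R] (fun u : tupleR k R => \prod_(i < k | P i) (tnth u i : R))%R.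
Proof.
rewrite (_ : (fun u => _) = (fun u : tupleR k R =>
    \prod_(i <- enum 'I_k | P i) (tnth u i : R))%R); last first.
  by apply/funext => u; rewrite big_enum_cond.
elim: (enum 'I_k) => [|i s ih].
  by under eq_fun do rewrite big_nil; exact: measurable_cst.
under eq_fun do rewrite big_cons; case: (P i) => //.
apply: measurable_funM => //.
exact: (@measurable_tnth _ (measurableTypeR R) k i).
Qed.

(** The first variable ranges over the open interval: its endpoints are null, and the logarithms and
    quotients to come need [0 < x < 1]. *)
Lemma integral_unit_cubeS k (g : tupleR k.+1 R -> \bar R) :
  measurable_fun [set: tupleR k.+1 R] g -> (forall u, 0 <= g u) ->
  \int[leb k.+1]_(u in cube k.+1) g u =
  \int[mu]_(x in I01) \int[leb k]_(u in cube k) g (pair_cons (x, u)).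
Proof.
move=> mg g0.
have mgp : measurable_fun [set: measurableTypeR R * tupleR k R] (fun z => g (pair_cons z)).
  by apply: (measurableT_comp mg); exact: measurable_pair_cons.
have mC : measurable [set z : measurableTypeR R * tupleR k R |
    `[0%R, 1%R]%classic z.1 /\ (fun=> cube k) z.1 z.2].
  by apply: (@measurableX _ _ (measurableTypeR R) (tupleR k R) `[0%R, 1%R]%classic (cube k)) => //;
    exact: measurable_unit_cube.
rewrite (_ : leb k.+1 = pushforward (mu \x leb k) (@pair_cons R k) :> (set _ -> _))//.
rewrite (ge0_integral_pushforward (@measurable_pair_cons R k))//; last 2 first.
  exact: measurable_unit_cube.
  exact: measurable_funTS.
rewrite (_ : @pair_cons R k @^-1` cube k.+1 = [set z : measurableTypeR R * tupleR k R |
    `[0%R, 1%R]%classic z.1 /\ (fun=> cube k) z.1 z.2]); last first.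
  apply/seteqP; split => [[x t]/= h|[x t]/= [h0 h] i].
    split; first by have := h ord0; rewrite in_itv.
    by move=> i; have := h (lift ord0 i); rewrite tnthS.
  case: (unliftP ord0 i) => [j ->|->]; last by move: h0; rewrite in_itv.
  by rewrite tnthS; exact: h.
transitivity (\int[mu]_(x in `[0%R, 1%R]) \int[leb k]_(u in cube k) g (pair_cons (x, u))).
  exact: (@integral_prod_region _ _ _ _ R mu (leb k) `[0%R, 1%R]%classic (fun=> cube k)
    (fun z => g (pair_cons z)) mgp (fun=> g0 _) mC).
rewrite integral_itv_bndoo//.
have mi : measurable_fun (`[0%R, 1%R]%classic : set (measurableTypeR R))
    (fun x : measurableTypeR R => \int[leb k]_(u in cube k) g (pair_cons (x, u))).
  apply (@measurable_integral_region _ _ (measurableTypeR R) _ R (leb k) `[0%R, 1%R]%classic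
    (fun=> cube k) (fun z => g (pair_cons z)) mgp (fun=> g0 _) mC).
  exact: measurable_itv.
by apply: measurable_funS mi => //; exact: subset_itv_oo_cc.
Qed.

(** The predicate lives on [nat], so that it can be shifted to [P i.+1] when the first variable is
    removed. *)
Lemma prod_pair_cons k (x : R) (u : tupleR k R) (P : nat -> bool) :
  (\prod_(i < k.+1 | P i) (tnth (pair_cons (x, u)) i : R) =
   (if P 0%N then x else 1) * \prod_(i < k | P i.+1) (tnth u i : R))%R.
Proof.
rewrite big_mkcond big_ord_recl/= [in RHS]big_mkcond/=; congr (_ * _)%R.
apply: eq_bigr => i _; rewrite /bump/= add1n; case: ifPn => // _.
by rewrite tnthS.
Qed.

Lemma integral_cube_prod m (h : R -> \bar R) :
  measurable_fun [set: R] h -> (forall x, 0 <= h x) ->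
  \int[leb m.+1]_(u in cube m.+1) h (\prod_(i < m.+1) (tnth u i : R))%R =
  \int[mu]_(x in I01) (h x * (lnpow m x)%:E).
Proof.
elim: m h => [|m ih] h mh h0.
  rewrite integral_unit_cubeS//; last exact: (measurableT_comp mh (measurable_prod_tnth _)).
  apply: eq_integral => x _.
  rewrite lnpow0 mule1 (eq_integral (cst (h x))); last first.
    move=> u _; congr h; rewrite (prod_pair_cons x u xpredT) big_ord0 mulr1//.
  rewrite integral_cst//=; last exact: measurable_unit_cube.
  by rewrite diracE mem_set ?mule1// => -[].
rewrite integral_unit_cubeS//; last exact: (measurableT_comp mh (measurable_prod_tnth _)).
rewrite -integral_lnpowS//; apply: eq_integral => x _.
rewrite -(ih (fun y => h (x * y)%R))//; last first.
  by apply: (measurableT_comp mh); exact: mulrl_measurable.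
by apply: eq_integral => u _; rewrite (prod_pair_cons x u xpredT).
Qed.

Lemma measurable_unit_square : measurable [set z : R * R | I01 z.1 /\ (fun=> I01) z.1 z.2].
Proof. by apply: (@measurableX _ _ (measurableTypeR R) (measurableTypeR R) I01 I01). Qed.

(** The groups have [r + 1] and [s + 1] variables, hence densities [lnpow r] and [lnpow s]. In the
    induction on [r], the variable peeled off multiplies the first group, and [integral_lnpowS]
    accounts for it. *)
Lemma integral_cube_prod2 r s (Phi : R * R -> \bar R) :
  measurable_fun [set: R * R] Phi -> (forall z, 0 <= Phi z) ->
  \int[leb (r + s).+2]_(u in cube (r + s).+2)
     Phi ((\prod_(i < (r + s).+2 | (i < r.+1)%N) (tnth u i : R))%R,
          (\prod_(i < (r + s).+2 | (r.+1 <= i)%N) (tnth u i : R))%R) =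
  \int[mu]_(x in I01) \int[mu]_(y in I01) (Phi (x, y) * (lnpow s y)%:E * (lnpow r x)%:E).
Proof.
have l0 k x : 0 <= (lnpow k x)%:E :> \bar R by rewrite lee_fin lnpow_ge0.
have ml k : measurable_fun [set: R] (EFin \o lnpow k).
  by apply/measurable_EFinP; exact: measurable_lnpow.
have mP2 k (P Q : pred 'I_k) Phi' : measurable_fun [set: R * R] Phi' ->
  measurable_fun [set: tupleR k R] (fun u : tupleR k R =>
    Phi' (\prod_(i < k | P i) (tnth u i : R), \prod_(i < k | Q i) (tnth u i : R))%R : \bar R).
  move=> mP'; apply: (measurableT_comp mP').
  by apply/measurable_fun_pairP; split; exact: measurable_prod_tnth.
elim: r Phi => [|r ih] Phi mPhi Phi0.
  rewrite integral_unit_cubeS//; last exact: mP2.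
  apply: eq_integral => x _.
  under [RHS]eq_integral do rewrite lnpow0 mule1.
  rewrite -(@integral_cube_prod s (fun y => Phi (x, y)))//; last first.
    by apply: measurableT_comp => //; exact: measurable_pair1.
  apply: eq_integral => u _; congr (Phi (_, _)).
    by rewrite (prod_pair_cons x u (fun i => i < 1)%N)/= big_pred0 ?mulr1.
  by rewrite (prod_pair_cons x u (fun i => 1 <= i)%N)/= mul1r.
rewrite [LHS]integral_unit_cubeS//; last exact: mP2.
pose h x := \int[mu]_(y in I01) (Phi (x, y) * (lnpow s y)%:E).
have h0 x : 0 <= h x.
  by apply: integral_ge0 => y _; rewrite mule_ge0.
have mPl : measurable_fun [set: R * R] (fun z => Phi z * (lnpow s z.2)%:E).
  by apply: emeasurable_funM => //; exact: (measurableT_comp (ml s)).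
have mh : measurable_fun [set: R] h.
  apply: (@measurable_integral_region _ _ (measurableTypeR R) (measurableTypeR R) R mu
    setT (fun=> I01) (fun z => Phi z * (lnpow s z.2)%:E) mPl _ _ measurableT).
    by move=> z; rewrite mule_ge0.
  rewrite (_ : mkset _ = setT `*` I01); last by apply/seteqP; split => z [].
  exact: measurableX.
transitivity (\int[mu]_(x in I01) (h x * (lnpow r.+1 x)%:E)); last first.
  apply: eq_integral => x _; rewrite /h ge0_integralZr//.
    by apply: measurable_funTS; apply: emeasurable_funM; [|exact: ml]; exact: measurableT_comp.
  by move=> y _; rewrite mule_ge0.
rewrite -integral_lnpowS//; apply: eq_integral => x _.
transitivity (\int[mu]_(y in I01) \int[mu]_(y0 in I01)
   (Phi (x * y, y0)%R * (lnpow s y0)%:E * (lnpow r y)%:E)); last first.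
  apply: eq_integral => y _; rewrite /h ge0_integralZr//.
    by apply: measurable_funTS; apply: emeasurable_funM; [|exact: ml]; exact: measurableT_comp.
  by move=> z _; rewrite mule_ge0.
rewrite -(ih (fun z => Phi (x * z.1, z.2)%R))//; last first.
  apply: (measurableT_comp mPhi); apply/measurable_fun_pairP.
  by split; [exact: measurable_funM|exact: measurable_snd].
apply: eq_integral => u _; congr (Phi (_, _)).
  by rewrite (prod_pair_cons x u (fun i => i < r.+2)%N)/=.
by rewrite (prod_pair_cons x u (fun i => r.+2 <= i)%N)/= mul1r.
Qed.

End cube_integrals.

(** * Reduction of the cube integrals to the unit square *)

Section two_dim_reduction.
Local Open Scope ereal_scope.
Context {R : realType}.
Let mu := @lebesgue_measure R.
Notation I01 := (`]0%R, 1%R[%classic : set R).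
Notation cube := (unit_cube R).
Notation leb := (lebesgue_tuple R).

(* The absolute value only serves to make [kern] nonnegative outside the unit square. *)
Definition kern n (z : R * R) : R :=
  (`|(1 - z.1 ^+ 4) ^+ n * (1 - z.2 ^+ 4) ^+ n / (1 - (z.1 * z.2) ^+ 2) ^+ (2 * n + 1)|)%R.

Lemma measurable_kern n : measurable_fun [set: R * R] (kern n).
Proof.
have m1 : measurable_fun [set: R * R] (fst : R * R -> R) by exact: measurable_fst.
have m2 : measurable_fun [set: R * R] (snd : R * R -> R) by exact: measurable_snd.
have mB (f : R * R -> R) : measurable_fun [set: R * R] f ->
    measurable_fun [set: R * R] (fun z => 1 - f z)%R.
  by move=> mf; apply: measurable_funB => //; exact: measurable_cst.
apply: measurableT_comp; first exact: normr_measurable.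
apply: measurable_funM.
  apply: measurable_funM; apply: measurable_funX; apply: mB; apply: measurable_funX.
    exact: m1.
  exact: m2.
apply: measurable_funV; apply: measurable_funX; apply: mB; apply: measurable_funX.
exact: measurable_funM.
Qed.

Lemma kern_ge0 n z : (0 <= kern n z)%R.
Proof. exact: normr_ge0. Qed.

Lemma prod_unit_itv k (P : pred 'I_k) (u : tupleR k R) : cube k u ->
  (0 <= \prod_(i < k | P i) (tnth u i : R) <= 1)%R.
Proof.
move=> cu; apply: (big_ind (fun x : R => 0 <= x <= 1)%R) => [|x y|i _].
- by rewrite ler01 lexx.
- by move=> /andP[x0 x1] /andP[y0 y1]; rewrite mulr_ge0//= mulr_ile1.
- exact: cu.
Qed.

Lemma J_integrandE k n r (u : tupleR k R) : cube k u ->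
  J_integrand n r u = kern n ((\prod_(i < k | (i < r)%N) (tnth u i : R))%R,
    (\prod_(i < k | (r <= i)%N) (tnth u i : R))%R).
Proof.
move=> cu; rewrite /J_integrand /kern /= !prodrXl.
have -> : (\prod_(i < k) (tnth u i : R) = \prod_(i < k | (i < r)%N) (tnth u i : R) *
    \prod_(i < k | (r <= i)%N) (tnth u i : R))%R.
  rewrite (bigID (fun i : 'I_k => (i < r)%N))/=; congr (_ * _)%R.
  by apply: eq_bigl => i; rewrite -leqNgt.
have /andP[x0 x1] := prod_unit_itv (fun i => (i < r)%N) cu.
have /andP[y0 y1] := prod_unit_itv (fun i => (r <= i)%N) cu.
rewrite ger0_norm// divr_ge0// ?mulr_ge0// exprn_ge0// subr_ge0 exprn_ile1//.
  by rewrite mulr_ge0.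
by rewrite mulr_ile1.
Qed.

Lemma sum_lnpow m (x y : R) : (0 < x < 1)%R -> (0 < y < 1)%R ->
  (\sum_(i < m.+1) lnpow (m - i) y * lnpow i x = lnpow m (x * y))%R.
Proof.
move=> /andP[x0 x1] /andP[y0 y1].
rewrite [RHS]lnpowE ?mulr_gt0//; last by rewrite mulr_ile1// ltW.
rewrite lnM ?posrE// opprD addrC exprDn mulr_suml; apply: eq_bigr => i _.
rewrite !lnpowE ?ltW//.
have im : (i <= m)%N by rewrite -ltnS.
rewrite -(bin_fact im) !natrM -mulr_natr.
have f0 k : (k`!%:R != 0 :> R)%R by rewrite pnatr_eq0 -lt0n fact_gt0.
have b0 : ('C(m, i)%:R != 0 :> R)%R by rewrite pnatr_eq0 -lt0n bin_gt0.
by field; rewrite !f0 b0.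
Qed.

Lemma integral_cube_J n r s :
  \int[leb (r + s).+2]_(u in cube (r + s).+2) (J_integrand n r.+1 u)%:E =
  \int[mu]_(x in I01) \int[mu]_(y in I01)
    ((kern n (x, y))%:E * (lnpow s y)%:E * (lnpow r x)%:E).
Proof.
rewrite -(@integral_cube_prod2 R r s (fun z => (kern n z)%:E)); last 2 first.
- by apply/measurable_EFinP; exact: measurable_kern.
- by move=> z; rewrite lee_fin kern_ge0.
by apply: eq_integral => u /set_mem cu; rewrite J_integrandE.
Qed.

Lemma sum_integral_cube_J n m :
  \sum_(i < m.+1) \int[mu]_(x in I01) \int[mu]_(y in I01)
    ((kern n (x, y))%:E * (lnpow (m - i) y)%:E * (lnpow i x)%:E) =
  \int[mu]_(p in I01) ((lnpow m p)%:E *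
    \int[mu]_(x in `]p, 1%R[) ((`|x|^-1)%:E * (kern n (x, p / x)%R)%:E)).
Proof.
have l0 k x : 0 <= (lnpow k x)%:E :> \bar R by rewrite lee_fin lnpow_ge0.
have k0 z : 0 <= (kern n z)%:E :> \bar R by rewrite lee_fin kern_ge0.
have ml k : measurable_fun [set: R] (EFin \o lnpow k).
  by apply/measurable_EFinP; exact: measurable_lnpow.
have mk : measurable_fun [set: R * R] (EFin \o kern n).
  by apply/measurable_EFinP; exact: measurable_kern.
have mi i : measurable_fun [set: R * R]
    (fun z => (kern n z)%:E * (lnpow (m - i) z.2)%:E * (lnpow i z.1)%:E).
  apply: emeasurable_funM; first apply: emeasurable_funM => //.
    exact: (measurableT_comp (ml _) measurable_snd).
  exact: (measurableT_comp (ml _) measurable_fst).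
rewrite -ge0_integral_sum//; last 2 first.
- move=> i; apply (@measurable_integral_region _ _ (measurableTypeR R) (measurableTypeR R) R mu
    I01 (fun=> I01) _ (mi i)) => //.
    by move=> z; rewrite !mule_ge0.
  exact: measurable_unit_square.
- by move=> i x _; apply: integral_ge0 => y _; rewrite !mule_ge0.
(* Writing [y] as [y * x / x] exhibits the integrand as a function of [x] and of the product
   [p = y * x], the form that [integral_mul_subst] accepts. *)
transitivity (\int[mu]_(x in I01) \int[mu]_(y in I01)
    ((kern n (x, y * x / x)%R)%:E * (lnpow m (y * x))%:E)).
  apply: eq_integral => x /set_mem/=; rewrite in_itv/= => x01.
  have x0 : (x != 0)%R by case/andP : x01 => /lt0r_neq0.
  rewrite -ge0_integral_sum//; last 2 first.
  - by move=> i; apply: measurable_funTS; apply: (measurableT_comp (mi i)); exact: measurable_pair1.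
  - by move=> i y _; rewrite !mule_ge0.
  apply: eq_integral => y /set_mem/=; rewrite in_itv/= => y01.
  rewrite mulfK// -EFinM [in RHS]mulrC [in RHS](mulrC y) -sum_lnpow// big_distrl/=.
  by rewrite -sumEFin; apply: eq_bigr => i _; rewrite -!EFinM; congr EFin; ring.
rewrite (@integral_mul_subst R (fun z => (kern n (z.1, z.2 / z.1)%R)%:E * (lnpow m z.2)%:E)); last 2 first.
- apply: emeasurable_funM; last exact: (measurableT_comp (ml _) measurable_snd).
  apply: (measurableT_comp mk); apply/measurable_fun_pairP; split; first exact: measurable_fst.
  apply: measurable_funM; first exact: measurable_snd.
  by apply/measurable_funV; exact: measurable_fst.
- by move=> z; rewrite mule_ge0.
apply: eq_integral => p _; rewrite -ge0_integralZl//.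
- by apply: eq_integral => x _; rewrite /= -!EFinM; congr EFin; ring.
- apply: measurable_funTS; apply: emeasurable_funM; first exact: measurable_invnorm.
  apply: (measurableT_comp mk); apply/measurable_fun_pairP; split; first exact: measurable_id.
  by apply: measurable_funM; [exact: measurable_cst|exact: measurable_inv].
- by move=> x _; rewrite mule_ge0// lee_fin invr_ge0.
Qed.

End two_dim_reduction.

(** * The substitution that fixes the bounds of the inner integral *)

Section change_of_variables.
Context {R : realType}.
Let mu := @lebesgue_measure R.

Lemma hasder_substitution_decreasing (F f G : R -> R) (a b : R) : 0 < a -> a < b ->
  (forall x : R, 0 < x -> hasder F x (f x)) ->
  (forall x : R, 0 < x -> {for x, continuous f}) ->
  {in `[a, b] &, {homo F : x y /~ x < y}} ->
  {in `[F b, F a], continuous G} ->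
  (\int[mu]_(x in `[F b, F a]) (G x)%:E =
   \int[mu]_(x in `[a, b]) (G (F x) * - f x)%:E)%E.
Proof.
move=> a0 ab dF cf Fdec cG.
have b0 : 0 < b by exact: lt_trans a0 ab.
have F'E (x : R) : 0 < x -> (F^`())%classic x = f x by move=> x0; exact/hasder_derive1/dF.
have cF' (x : R) : 0 < x -> (F^`())%classic y @[y --> x] --> f x.
  move=> x0; apply: cvg_trans (cf _ x0); apply: near_eq_cvg.
  near=> y; rewrite F'E//.
  by near: y; exact: lt_nbhsr.
rewrite (integration_by_substitution_decreasing (ltW ab) Fdec).
- apply: eq_integral => x /set_mem/=; rewrite in_itv/= => /andP[ax _].
  by rewrite mulrfctE opprfctE /= F'E// (lt_le_trans a0 ax).
- move=> x; rewrite in_itv/= => /andP[ax _]; have x0 := lt_trans a0 ax.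
  by rewrite /continuous_at F'E//; exact: cF'.
- by apply/cvg_ex; exists (f a); apply: cvg_at_right_filter; exact: cF'.
- by apply/cvg_ex; exists (f b); apply: cvg_at_left_filter; exact: cF'.
- split.
  + move=> x; rewrite in_itv/= => /andP[ax _].
    exact: (@ex_derive _ _ _ _ _ _ _ (dF x (lt_trans a0 ax))).
  + exact/cvg_at_right_filter/hasder_continuous/dF.
  + exact/cvg_at_left_filter/hasder_continuous/dF.
- by apply: continuous_in_subspaceT => x /set_mem; exact: cG.
Unshelve. all: by end_near. Qed.

(** With [a = p^2 / x^2] and [b = x^2] one has [a b = p^2], and the new variable is defined by
    [a - b = (1 - p^2) y]; so [disc p y = (a - b)^2 + 4 a b = (a + b)^2], a perfect square along the
    substitution. *)
Definition disc (p y : R) : R := 4 * p ^+ 2 + (1 - p ^+ 2) ^+ 2 * y ^+ 2.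

Definition sfun (p y : R) : R := (Num.sqrt (disc p y))^-1.

Lemma disc_gt0 p y : 0 < p -> 0 < disc p y.
Proof.
move=> p0; rewrite /disc ltr_pwDl//; first by rewrite mulr_gt0// exprn_gt0.
by rewrite mulr_ge0 ?sqr_ge0.
Qed.

Lemma sqrt_disc_gt0 p y : 0 < p -> 0 < Num.sqrt (disc p y).
Proof. by move=> p0; rewrite sqrtr_gt0 disc_gt0. Qed.

Lemma sfun_gt0 p y : 0 < p -> 0 < sfun p y.
Proof. by move=> p0; rewrite invr_gt0 sqrt_disc_gt0. Qed.

Lemma sfun_sqr p y : 0 < p -> sfun p y ^+ 2 * disc p y = 1.
Proof.
move=> p0; rewrite /sfun exprVn sqr_sqrtr; last exact/ltW/disc_gt0.
by rewrite mulVf// gt_eqF// disc_gt0.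
Qed.

Lemma hasder_disc_y p y : hasder (disc p) y (2 * (1 - p ^+ 2) ^+ 2 * y).
Proof.
apply: hasder_eq (hasderD (hasder_cst _ _) (hasderM (hasder_cst _ _) (hasderX 2 (hasder_id _)))) _.
by rewrite /= expr1; ring.
Qed.

Lemma hasder_disc_p p y : hasder (disc^~ y) p (8 * p - 4 * p * (1 - p ^+ 2) * y ^+ 2).
Proof.
apply: hasder_eq (hasderD (hasderM (hasder_cst _ _) (hasderX 2 (hasder_id _)))
  (hasderM (hasderX 2 (hasderB (hasder_cst _ _) (hasderX 2 (hasder_id _)))) (hasder_cst _ _))) _.
by rewrite /= !expr1; ring.
Qed.

Lemma hasder_invsqrt (f : R -> R) x d : 0 < f x -> hasder f x d ->
  hasder (fun y => (Num.sqrt (f y))^-1) x (- (d / 2) * (Num.sqrt (f x))^-1 ^+ 3).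
Proof.
move=> f0 h; have s0 : 0 < Num.sqrt (f x) by rewrite sqrtr_gt0.
apply: hasder_eq (@hasderV _ (fun y => Num.sqrt (f y)) _ _ (lt0r_neq0 s0) (hasder_sqrt f0 h)) _.
by field; rewrite gt_eqF.
Qed.

Lemma hasder_sfun_y p y : 0 < p ->
  hasder (sfun p) y (- ((1 - p ^+ 2) ^+ 2 * y) * sfun p y ^+ 3).
Proof.
move=> p0; apply: hasder_eq (hasder_invsqrt (disc_gt0 y p0) (hasder_disc_y p y)) _.
by rewrite /sfun; field; rewrite gt_eqF// sqrt_disc_gt0.
Qed.

Lemma hasder_sfun_p p y : 0 < p ->
  hasder (sfun^~ y) p (- (4 * p - 2 * p * (1 - p ^+ 2) * y ^+ 2) * sfun p y ^+ 3).
Proof.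
move=> p0; apply: hasder_eq (@hasder_invsqrt (disc^~ y) p _ (disc_gt0 y p0) (hasder_disc_p p y)) _.
by rewrite /sfun; field; rewrite gt_eqF// sqrt_disc_gt0.
Qed.

Lemma hasder_q n (y : R) : hasder (fun y => (1 - y ^+ 2) ^+ n) y
  (- (2 * n%:R * y * (1 - y ^+ 2) ^+ n.-1)).
Proof.
apply: hasder_eq (hasderX n (hasderB (hasder_cst _ _) (hasderX 2 (hasder_id _)))) _.
by rewrite /= expr1; ring.
Qed.

(* With [x^2 = e^-a] and [p = e^(-t/2)] this is the substitution
   [y = sinh (a - t/2) / sinh (t/2)], for which
   [1 - y^2 = (1 - x^4) (1 - (p/x)^4) / (1 - p^2)^2]. *)
Lemma integral_kern n (p : R) : 0 < p -> p < 1 ->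
  (\int[mu]_(x in `]p, 1%R[) ((`|x|^-1)%:E * (kern n (x, p / x)%R)%:E) =
   (2^-1)%:E * \int[mu]_(y in `[(-1)%R, 1%R]) ((1 - y ^+ 2) ^+ n * sfun p y)%:E)%E.
Proof.
move=> p0 p1.
have q0 : 0 < 1 - p ^+ 2 by rewrite subr_gt0 expr_lt1// ltW.
pose F (x : R) := (p ^+ 2 * (x ^+ 2)^-1 - x ^+ 2) * (1 - p ^+ 2)^-1.
pose f (x : R) := - (2 * (p ^+ 2 * (x ^+ 3)^-1 + x) * (1 - p ^+ 2)^-1).
have dF x : 0 < x -> hasder F x (f x).
  move=> x0; have x20 : x ^+ 2 != 0 by rewrite expf_eq0/= gt_eqF.
  apply: hasder_eq (hasderM (hasderB (hasderM (hasder_cst (p ^+ 2) x)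
    (@hasderV _ (fun y => y ^+ 2) _ _ x20 (hasderX 2 (hasder_id x)))) (hasderX 2 (hasder_id x))) (hasder_cst _ _)) _.
  by rewrite /f/= !expr1; field; rewrite !gt_eqF.
have cf x : 0 < x -> {for x, continuous f}.
  move=> x0; have x30 : x ^+ 3 != 0 by rewrite expf_eq0/= gt_eqF.
  apply: hasder_continuous.
  exact: hasderN (hasderM (hasderM (hasder_cst 2 x) (hasderD (hasderM (hasder_cst (p ^+ 2) x)
    (@hasderV _ (fun y => y ^+ 3) _ _ x30 (hasderX 3 (hasder_id x)))) (hasder_id x))) (hasder_cst _ _)).
have Fp : F p = 1 by rewrite /F; field; rewrite !gt_eqF.
have F1 : F 1 = -1 by rewrite /F; field; rewrite !gt_eqF.
have Fdec : {in `[p, 1] &, {homo F : x y /~ x < y}}.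
  move=> x y; rewrite !in_itv/= => /andP[px _] /andP[py _] yx.
  have y0 : 0 < y by exact: lt_le_trans p0 py.
  have x0 : 0 < x by exact: lt_le_trans p0 px.
  have xy2 : y ^+ 2 < x ^+ 2 by rewrite ltrXn2r// ?nnegrE ltW.
  rewrite ltr_pM2r ?invr_gt0// ltrD// ?ltrN2//.
  by rewrite ltr_pM2l ?exprn_gt0// ltf_pV2// ?posrE exprn_gt0.
pose G y := (1 - y ^+ 2) ^+ n * sfun p y.
have cG : {in `[F 1, F p], continuous G}.
  move=> y _; apply: hasder_continuous; exact: hasderM (hasder_q n y) (hasder_sfun_y y p0).
have := hasder_substitution_decreasing p0 p1 dF cf Fdec cG.
rewrite Fp F1 => ->.
have mk : measurable_fun setT (fun x : R => (`|x|^-1 * kern n (x, p / x)%R)%:E).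
  apply/measurable_EFinP/measurable_funM.
    by apply/measurable_EFinP; exact: measurable_invnorm.
  apply: (measurableT_comp (measurable_kern n)); apply/measurable_fun_pairP.
  split; first exact: measurable_id.
  by apply: measurable_funM; [exact: measurable_cst|exact: measurable_inv].
under eq_integral do rewrite -EFinM.
rewrite -(@integral_itv_bndoo _ p 1 _ true false); last exact: measurable_funTS.
(* The powers of [1 - p^2] add up to the exponent [2n + 1] of [kern]: [2n] come from
   [(1 - F x ^+ 2) ^+ n] and one from [f]. *)
have E x : p <= x <= 1 -> G (F x) * - f x = 2 * (`|x|^-1 * kern n (x, p / x)%R).
  move=> /andP[px x1]; have x0 : 0 < x by exact: lt_le_trans p0 px.
  have x40 : 0 <= 1 - x ^+ 4 by rewrite subr_ge0 exprn_ile1// ltW.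
  have y40 : 0 <= 1 - (p / x) ^+ 4.
    rewrite subr_ge0 exprn_ile1//; first by rewrite divr_ge0// ltW.
    by rewrite ler_pdivrMr ?mul1r.
  have sE : sfun p (F x) = (p ^+ 2 / x ^+ 2 + x ^+ 2)^-1.
    rewrite /sfun (_ : disc p (F x) = (p ^+ 2 / x ^+ 2 + x ^+ 2) ^+ 2); last first.
      by rewrite /disc /F; field; rewrite !gt_eqF.
    by rewrite sqrtr_sqr ger0_norm// addr_ge0// ?divr_ge0 ?sqr_ge0.
  rewrite /kern /= (_ : x * (p / x) = p); last by field; rewrite gt_eqF.
  rewrite (gtr0_norm x0) ger0_norm; last first.
    by rewrite mulr_ge0 ?invr_ge0// ?mulr_ge0// exprn_ge0// ltW.
  rewrite /G sE (_ : 1 - F x ^+ 2 =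
     (1 - x ^+ 4) * (1 - (p / x) ^+ 4) * ((1 - p ^+ 2) ^+ 2)^-1); last first.
    by rewrite /F; field; rewrite !gt_eqF.
  move: (1 - (p / x) ^+ 4) (1 - x ^+ 4) => B A.
  rewrite !exprMn /f exprVn -exprM exprD expr1 mulnC.
  have Q0 : (1 - p ^+ 2) ^+ (n * 2) != 0 by rewrite expf_eq0 gt_eqF// andbF.
  set Q := (1 - p ^+ 2) ^+ (n * 2) in Q0 *.
  have s0 : p ^+ 2 / x ^+ 2 + x ^+ 2 != 0.
    by rewrite gt_eqF// addr_gt0// ?divr_gt0// exprn_gt0.
  by field; rewrite Q0 (gt_eqF q0) (gt_eqF x0)/= gt_eqF// ltr_pwDl ?exprn_gt0// sqr_ge0.
transitivity ((2^-1)%:E * \int[mu]_(x in `[p, 1%R])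
    (2%:E * (`|x|^-1 * kern n (x, p / x)%R)%:E))%E; last first.
  congr (_ * _)%E; apply: eq_integral => x /set_mem/=.
  by rewrite in_itv/= => /E ->; rewrite EFinM.
rewrite ge0_integralZl//.
- by rewrite muleA -EFinM mulVf// mul1e.
- exact: measurable_funTS.
- by move=> x _; rewrite lee_fin mulr_ge0 ?kern_ge0.
Qed.

End change_of_variables.

(** * [J] as an integral against a logarithmic weight, and integrability *)

Section J_formula.
Context {R : realType}.
Let mu := @lebesgue_measure R.
Notation I01 := (`]0%R, 1%R[%classic : set R).
Notation Im := (`[(-1)%R, 1%R]%classic : set R).

Definition bint n (p : R) : R := \int[mu]_(y in Im) ((1 - y ^+ 2) ^+ n * sfun p y).

Lemma q_ge0 (y : R) : Im y -> 0 <= 1 - y ^+ 2.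
Proof.
rewrite /= in_itv/= => /andP[y1 y2].
by rewrite (_ : 1 - y ^+ 2 = (1 - y) * (1 + y)); [rewrite mulr_ge0//; lra|ring].
Qed.

Lemma q_le1 (y : R) : 1 - y ^+ 2 <= 1.
Proof. by rewrite gerBl sqr_ge0. Qed.

Lemma continuous_integrable_Im (f : R -> R) : continuous f ->
  mu.-integrable Im (EFin \o f).
Proof.
move=> cf; apply: continuous_compact_integrable; first exact: segment_compact.
exact: continuous_subspaceT.
Qed.

Lemma continuous_bint_integrand n p : 0 < p ->
  continuous (fun y : R => (1 - y ^+ 2) ^+ n * sfun p y).
Proof.
move=> p0 y; apply: hasder_continuous.
exact: hasderM (hasder_q n y) (hasder_sfun_y y p0).
Qed.

Lemma bint_integrable n p : 0 < p ->
  mu.-integrable Im (fun y : R => ((1 - y ^+ 2) ^+ n * sfun p y)%:E).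
Proof. by move=> p0; exact/continuous_integrable_Im/continuous_bint_integrand. Qed.

Lemma EFin_bint n p : 0 < p ->
  (bint n p)%:E = (\int[mu]_(y in Im) ((1 - y ^+ 2) ^+ n * sfun p y)%:E)%E.
Proof.
move=> p0; rewrite /bint /Rintegral fineK//.
exact: integrable_fin_num (bint_integrable n p0).
Qed.

Lemma bint_ge0 n p : 0 < p -> 0 <= bint n p.
Proof.
move=> p0; apply: Rintegral_ge0 => y Iy.
by rewrite mulr_ge0 ?exprn_ge0 ?q_ge0// ltW// sfun_gt0.
Qed.

Lemma bint_le n p : 0 < p -> bint n p <= bint 0 p.
Proof.
move=> p0; apply: le_Rintegral => //; [exact: bint_integrable|exact: bint_integrable|].
move=> y Iy; apply: ler_wpM2r; first exact/ltW/sfun_gt0.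
by rewrite expr0 exprn_ile1// ?q_ge0// q_le1.
Qed.

(** For [n = 0] the substitution is read backwards: [kern 0 (x, p / x)] is the constant
    [1 / (1 - p^2)], and only the integral of [1 / x] remains. *)
Lemma bint0E p : 0 < p -> p < 1 -> bint 0 p = 2 * (lnpow 1 p / (1 - p ^+ 2)).
Proof.
move=> p0 p1; have q0 : 0 < 1 - p ^+ 2 by rewrite subr_gt0 expr_lt1// ltW.
have := integral_kern 0 p0 p1; rewrite -EFin_bint//.
rewrite (@eq_integral _ _ _ mu _ (fun x : R => ((1 - p ^+ 2)^-1)%:E *
    ((`|x|^-1)%:E * (lnpow 0 x)%:E))%E); last first.
  move=> x /set_mem/=; rewrite in_itv/= => /andP[px x1].
  rewrite lnpow0 mule1 muleC /kern/= !expr0 !mul1r muln0 add0n expr1.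
  rewrite (_ : x * (p / x) = p); last by field; rewrite gt_eqF// (lt_trans p0).
  by rewrite ger0_norm// invr_ge0 ltW.
rewrite ge0_integralZl//; last 3 first.
- apply: measurable_funTS; apply: emeasurable_funM; first exact: measurable_invnorm.
  by apply/measurable_EFinP; exact: measurable_lnpow.
- by move=> x _; rewrite mule_ge0// lee_fin ?lnpow_ge0.
- by rewrite lee_fin invr_ge0 ltW.
rewrite integral_lnpow_div// -!EFinM => -[h].
by rewrite [lnpow 1 p / _]mulrC h mulrA mulfV// mul1r.
Qed.

Lemma lnpow_mul1 m p : lnpow m p * lnpow 1 p = m.+1%:R * lnpow m.+1 p :> R.
Proof.
have f0 : m`!%:R != 0 :> R by rewrite pnatr_eq0 -lt0n fact_gt0.
rewrite /lnpow [m.+1`!]factS natrM [_ ^+ m.+1]exprS expr1 factS fact0.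
by field; rewrite f0/= addrC natr1 pnatr_eq0.
Qed.

(** From [-ln p <= 1/p - 1] one gets [(-ln p) p^2 <= p - p^2 <= 1 - p^2]: the pole of
    [1 / (1 - p^2)] at 1 is compensated and only a logarithm at 0 is left. The bound is uniform in
    [n] and integrable against every [lnpow m]. *)
Lemma bint_bound n p : 0 < p -> p < 1 -> bint n p <= 2 * (1 + lnpow 1 p).
Proof.
move=> p0 p1; have q0 : 0 < 1 - p ^+ 2 by rewrite subr_gt0 expr_lt1// ltW.
apply: (le_trans (bint_le n p0)); rewrite bint0E// ler_pM2l// ler_pdivrMr//.
have l1 : lnpow 1 p = - ln p by rewrite lnpowE// ?ltW// expr1 divr1.
have ip : 0 < p^-1 by rewrite invr_gt0.
have h : - ln p <= p^-1 - 1.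
  by rewrite -lnV ?posrE//; have := @le_ln1Dx _ (p^-1 - 1); rewrite (_ : 1 + (p^-1 - 1) = p^-1); [apply; lra|ring].
have h2 : (- ln p) * p ^+ 2 <= (p^-1 - 1) * p ^+ 2 by rewrite ler_wpM2r// sqr_ge0.
rewrite l1.
have : (p^-1 - 1) * p ^+ 2 = p - p ^+ 2 by field; rewrite gt_eqF.
by nra.
Qed.

Lemma measurable_sfun : measurable_fun [set: R * R] (fun z : R * R => sfun z.1 z.2).
Proof.
have m1 : measurable_fun [set: R * R] (fst : R * R -> R) by exact: measurable_fst.
have m2 : measurable_fun [set: R * R] (snd : R * R -> R) by exact: measurable_snd.
apply: measurable_funV; apply: measurableT_comp; first exact: measurable_sqrt.
apply: measurable_funD.
  by apply: measurable_funM; [exact: measurable_cst|exact: measurable_funX].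
apply: measurable_funM; last exact: measurable_funX.
apply: measurable_funX; apply: measurable_funB; first exact: measurable_cst.
exact: measurable_funX.
Qed.

Lemma measurable_q d (T : measurableType d) (f : T -> R) n :
  measurable_fun [set: T] f -> measurable_fun [set: T] (fun z => (1 - f z ^+ 2) ^+ n).
Proof.
move=> mf; apply: measurable_funX; apply: measurable_funB; first exact: measurable_cst.
exact: measurable_funX.
Qed.

Lemma measurable_bint n : measurable_fun I01 (bint n).
Proof.
apply/measurable_EFinP.
pose f (z : R * R) := (`|(1 - z.2 ^+ 2) ^+ n * sfun z.1 z.2|)%:E.
have mf : measurable_fun [set: R * R] f.
  apply/measurable_EFinP; apply: measurableT_comp; first exact: normr_measurable.
  apply: measurable_funM; last exact: measurable_sfun.
  by apply: measurable_q; exact: measurable_snd.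
apply: (@eq_measurable_fun _ _ (measurableTypeR R) _ _ (fun p => \int[mu]_(y in Im) f (p, y))%E).
  move=> p /set_mem/=; rewrite in_itv/= => /andP[p0 _]; rewrite EFin_bint//.
  apply: eq_integral => y /set_mem Iy; rewrite /f /= ger0_norm//.
  by rewrite mulr_ge0 ?exprn_ge0 ?q_ge0// ltW// sfun_gt0.
apply (@measurable_integral_region _ _ (measurableTypeR R) (measurableTypeR R) R mu
    I01 (fun=> Im) f mf) => //.
  by move=> z; rewrite lee_fin normr_ge0.
by apply: (@measurableX _ _ (measurableTypeR R) (measurableTypeR R) I01 Im).
Qed.

Lemma integrable_lnpow_bint m n :
  mu.-integrable I01 (fun p => (lnpow m p * bint n p)%:E).
Proof.
have il k : mu.-integrable I01 (fun p => (lnpow k p)%:E).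
  apply/integrableP; split.
    by apply/measurable_funTS/measurable_EFinP; exact: measurable_lnpow.
  under eq_integral do rewrite gee0_abs ?lee_fin ?lnpow_ge0//.
  by rewrite integral_lnpow ltry.
have ig : mu.-integrable I01 (fun p => (2 * lnpow m p + 2 * m.+1%:R * lnpow m.+1 p)%:E).
  have mI : measurable (I01 : set (measurableTypeR R)) by exact: measurable_itv.
  have := integrableD mI (integrableZl mI 2 (il m)) (integrableZl mI (2 * m.+1%:R) (il m.+1)).
  by apply: eq_integrable.
apply: le_integrable ig => //.
  apply/measurable_EFinP; apply: measurable_funM; last exact: measurable_bint.
  by apply: measurable_funTS; exact: measurable_lnpow.
move=> p /=; rewrite in_itv/= => /andP[p0 p1]; rewrite lee_fin.
rewrite !ger0_norm ?mulr_ge0 ?lnpow_ge0 ?bint_ge0//; last first.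
  by rewrite addr_ge0// !mulr_ge0// lnpow_ge0.
apply: le_trans (ler_wpM2l (lnpow_ge0 m p) (bint_bound n p0 p1)) _.
by have := lnpow_mul1 m p; lra.
Qed.

Definition wint m n : R := \int[mu]_(p in I01) (lnpow m p * bint n p).

Lemma EFin_wint m n : (wint m n)%:E = (\int[mu]_(p in I01) (lnpow m p * bint n p)%:E)%E.
Proof.
by rewrite /wint /Rintegral fineK//; exact: integrable_fin_num (integrable_lnpow_bint m n).
Qed.

Lemma sum_integral_cube_J_wint n m :
  (\sum_(i < m.+1) \int[mu]_(x in I01) \int[mu]_(y in I01)
    ((kern n (x, y))%:E * (lnpow (m - i) y)%:E * (lnpow i x)%:E) = (2^-1 * wint m n)%:E)%E.
Proof.
rewrite sum_integral_cube_J EFinM EFin_wint.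
rewrite -ge0_integralZl//; last 2 first.
- by have /integrableP[] := integrable_lnpow_bint m n.
- by move=> p; rewrite /= in_itv/= => /andP[p0 _]; rewrite lee_fin mulr_ge0 ?lnpow_ge0 ?bint_ge0.
apply: eq_integral => p /set_mem/=; rewrite in_itv/= => /andP[p0 p1].
by rewrite integral_kern// -EFin_bint// -!EFinM; congr EFin; ring.
Qed.

(** All terms of the sum over [r] are nonnegative, so each is at most the sum, whose value
    [2^-1 * wint] is finite. *)
Lemma J_integral_lty n r s :
  (\int[lebesgue_tuple R (r + s).+2]_(u in unit_cube R (r + s).+2)
    (J_integrand n r.+1 u)%:E < +oo)%E.
Proof.
have k0 m (i : 'I_m.+1) : (0 <= \int[mu]_(x in I01) \int[mu]_(y in I01)
    ((kern n (x, y))%:E * (lnpow (m - i) y)%:E * (lnpow i x)%:E))%E.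
  by do 2! (apply: integral_ge0 => ? _); rewrite !mule_ge0// lee_fin ?kern_ge0 ?lnpow_ge0.
rewrite integral_cube_J; have := sum_integral_cube_J_wint n (r + s).
have rs : (r < (r + s).+1)%N by rewrite ltnS leq_addr.
rewrite (bigD1 (Ordinal rs))//= addKn => h.
apply: (@le_lt_trans _ _ (2^-1 * wint (r + s) n)%:E); last exact: ltry.
by rewrite -h leeDl// sume_ge0.
Qed.

Lemma J_integrable k n r : (1 <= r < k)%N ->
  (lebesgue_tuple R k).-integrable (unit_cube R k) (fun u => (J_integrand n r u)%:E).
Proof.
case: r => // r /= rk.
have [s ->] : exists s, k = (r + s).+2 by exists (k - r.+2)%N; lia.
set f := fun u : tupleR (r + s).+2 R =>
  (kern n ((\prod_(i < (r + s).+2 | (i < r.+1)%N) (tnth u i : R))%R,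
    (\prod_(i < (r + s).+2 | (r.+1 <= i)%N) (tnth u i : R))%R)).
suff : (lebesgue_tuple R (r + s).+2).-integrable (unit_cube R (r + s).+2) (EFin \o f).
  apply: eq_integrable; first exact: measurable_unit_cube.
  by move=> u /set_mem cu; rewrite J_integrandE.
apply/integrableP; split.
  apply: measurable_funTS; apply/measurable_EFinP; apply: (measurableT_comp (measurable_kern n)).
  by apply/measurable_fun_pairP; split; exact: measurable_prod_tnth.
apply: le_lt_trans (J_integral_lty n r s).
rewrite le_eqVlt; apply/orP; left; apply/eqP; apply: eq_integral => u /set_mem cu.
by rewrite J_integrandE// gee0_abs// lee_fin kern_ge0.
Qed.

(** Of the [m + 2] factors 2 in [J], one is cancelled by the [2^-1] of the substitution. *)
Lemma JE m n : J R m.+2 n = 2 ^+ m.+1 * wint m n.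
Proof.
rewrite /J -big_distrr/= exprS -mulrA mulrC.
suff -> : \sum_(1 <= r < m.+2) \int[lebesgue_tuple R m.+2]_(u in unit_cube R m.+2)
    J_integrand n r u = 2^-1 * wint m n.
  by field.
rewrite big_add1/= big_mkord; apply: EFin_inj; rewrite -sum_integral_cube_J_wint -sumEFin.
apply: eq_bigr => i _.
have im : (i + (m - i))%N = m by rewrite subnKC// -ltnS.
have := J_integral_lty n i (m - i); rewrite im => fin.
rewrite /Rintegral fineK; last first.
  rewrite ge0_fin_numE//; apply: integral_ge0 => u cu.
  by rewrite J_integrandE// lee_fin kern_ge0.
by have := @integral_cube_J R n i (m - i); rewrite im; apply.
Qed.

End J_formula.

(** * Exact derivatives in [p] and in [y] *)

Section potentials.
Context {R : realType}.
Implicit Types p y : R.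

(* The coefficient of [z^n] in the differential operator applied to [sum_i a_i z^i]. *)
Definition apery_rec (n : nat) (a : nat -> R) : R :=
  n.+1%:R ^+ 2 * a n.+1 - (2 * n%:R ^+ 2 + 2 * n%:R + 3 / 4) * a n
  + n%:R ^+ 2 * a n.-1.

(** With [G = p * sfun p y] and [D = p d/dp], [p * vfun p y] is [D G] and, below, [p * wfun p y] is
    [D^2 G]. The explicit forms let continuity and bounds be read off. *)
Definition vfun p y := (1 - p ^+ 4) * y ^+ 2 * sfun p y ^+ 3.

Definition wfun p y := (1 - 5 * p ^+ 4) * y ^+ 2 * sfun p y ^+ 3
  - 3 * (p * (1 - p ^+ 4) * y ^+ 2) * (4 * p - 2 * p * (1 - p ^+ 2) * y ^+ 2) * sfun p y ^+ 5.

Lemma sfunE3 p y : 0 < p -> sfun p y = sfun p y ^+ 3 * disc p y.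
Proof. by move=> p0; rewrite exprS -mulrA sfun_sqr// mulr1. Qed.

Lemma sfun3E5 p y : 0 < p -> sfun p y ^+ 3 = sfun p y ^+ 5 * disc p y.
Proof. by move=> p0; rewrite [_ ^+ 5](@exprD _ _ 3 2) -mulrA sfun_sqr// mulr1. Qed.

Lemma hasder_psfun p y : 0 < p -> hasder (fun p => p * sfun p y) p (vfun p y).
Proof.
move=> p0; apply: hasder_eq (hasderM (hasder_id p) (hasder_sfun_p y p0)) _.
by rewrite mul1r [X in X + _]sfunE3// /vfun /disc; ring.
Qed.

Lemma hasder_pvfun p y : 0 < p -> hasder (fun p => p * vfun p y) p (wfun p y).
Proof.
move=> p0; apply: hasder_eq (hasderM (hasder_id p) (hasderM (hasderM
  (hasderB (hasder_cst _ _) (hasderX 4 (hasder_id p))) (hasder_cst (y ^+ 2) p))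
  (hasderX 3 (hasder_sfun_p y p0)))) _.
by rewrite /wfun /=; ring.
Qed.

(* [lwt k] is the weight attached to [w_k]: it vanishes for [k < 2]. *)
Definition lwt k p : R := if k is k'.+2 then (- ln p) ^+ k' / k'`!%:R else 0.

Lemma hasder_lwt k p : 0 < p -> hasder (lwt k.+1) p (- (lwt k p / p)).
Proof.
move=> p0; case: k => [|[|k]] /=.
- by rewrite mul0r oppr0; exact: hasder_cst.
- rewrite mul0r oppr0 (_ : lwt 2 = fun=> 1); first exact: hasder_cst.
  by apply/funext => x; rewrite /= expr0 fact0 divr1.
- exact: hasder_nlnpow.
Qed.

Lemma lwt_lnpow k p : 0 < p -> p <= 1 -> lwt k.+2 p = lnpow k p.
Proof. by move=> p0 p1; rewrite lnpowE. Qed.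

(* [hpot] performs two integrations by parts in [log p] at once. *)
Definition hpot j p y := lwt j.+2 p * (p * vfun p y) + lwt j.+1 p * (p * sfun p y).

(** The two cross terms [lwt j.+1 p * vfun p y] have opposite signs and cancel. *)
Lemma hasder_hpot j p y : 0 < p ->
  hasder (hpot j ^~ y) p (lwt j.+2 p * wfun p y - lwt j p * sfun p y).
Proof.
move=> p0; apply: hasder_eq (hasderD (hasderM (hasder_lwt j.+1 p0) (hasder_pvfun y p0))
  (hasderM (hasder_lwt j p0) (hasder_psfun y p0))) _.
by field; rewrite gt_eqF.
Qed.

(** At [p = 1], [vfun] vanishes through [1 - p^4] and [disc] is 4, so [sfun] is 1/2. The weight
    [lwt j.+1] is 1 there only for [j = 1]: it is zero for [j = 0], and a positive power of [- ln 1]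
    for [j >= 2]. *)
Lemma hpot1 j y : hpot j 1 y = if j == 1%N then 2^-1 else 0.
Proof.
rewrite /hpot /vfun expr1n subrr !(mul0r, mulr0, add0r, mul1r).
have -> : sfun 1 y = 2^-1.
  rewrite /sfun /disc expr1n subrr expr0n/= mul0r addr0 mulr1.
  by rewrite (_ : 4 = 2 ^+ 2 :> R); [rewrite sqrtr_sqr ger0_norm|ring].
case: j => [|[|j]] /=; first by rewrite mul0r.
  by rewrite expr0 fact0 divr1 mul1r.
by rewrite ln1 oppr0 expr0n/= !mul0r.
Qed.

(** The certificate, in the sense of creative telescoping, of the recurrence in [n]. It vanishes at
    [y^2 = 1] even for [n = 0], since its only term without an inner factor [1 - y^2] carries the
    coefficient [n]. *)
Definition ypot n p y := (1 - y ^+ 2) ^+ n * (y * (- (n%:R / 2) * y ^+ 2 * sfun p y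
  + (1 - y ^+ 2) * (p ^+ 2 + (1 - p ^+ 2) ^+ 2 * y ^+ 2 / 2) * sfun p y ^+ 3)).

(* The recurrence holds at the level of the integrands up to an exact derivative. *)
Lemma hasder_ypot n p y : 0 < p ->
  hasder (ypot n p) y (apery_rec n (fun i => (1 - y ^+ 2) ^+ i * sfun p y)
    - (1 - y ^+ 2) ^+ n * wfun p y / 4).
Proof.
move=> p0; have ds := hasder_sfun_y y p0.
have dy2 : hasder (fun y => y ^+ 2) y (2 * y).
  by apply: hasder_eq (hasderX 2 (hasder_id y)) _; rewrite /= expr1; ring.
have d1 := hasderM (hasderM (hasder_cst (- (n%:R / 2)) y) dy2) ds.
have d2 := hasderM (hasderM (hasderB (hasder_cst 1 y) dy2)
  (hasderD (hasder_cst (p ^+ 2) y)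
  (hasderM (hasderM (hasder_cst ((1 - p ^+ 2) ^+ 2) y) dy2) (hasder_cst (2^-1) y)))) (hasderX 3 ds).
apply: hasder_eq (hasderM (hasder_q n y) (hasderM (hasder_id y) (hasderD d1 d2))) _.
rewrite /apery_rec /wfun /=.
(* Every power of [sfun] is written as its fifth power times a power of [disc]; with that fifth
   power made opaque, a polynomial identity remains. *)
have s1 : sfun p y = sfun p y ^+ 5 * disc p y ^+ 2.
  by rewrite expr2 mulrA -sfun3E5// -sfunE3.
have s3 := sfun3E5 y p0.
have s2 : sfun p y ^+ 2 * sfun p y ^+ 3 = sfun p y ^+ 5 by rewrite -exprD.
have s4 c : 3 * sfun p y ^+ 2 * (c * sfun p y ^+ 3) = 3 * c * sfun p y ^+ 5.
  by rewrite -s2; ring.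
rewrite s4; move: s1 s3 {s2 s4 d1 d2 ds}.
move: (sfun p y) (sfun p y ^+ 3) (sfun p y ^+ 5) => S1 S3 S5 -> ->; rewrite /disc.
case: n => [|n] /=.
  by rewrite !expr0 !expr1; field.
rewrite -[n.+2%:R]natr1 -[n.+1%:R]natr1 !exprS.
by move: ((1 - y ^+ 2) ^+ n) (n%:R) => Q N; field.
Qed.

End potentials.

(** * Linearity, Fubini on rectangles, and exhaustion of []0, 1[] *)

Section integral_tools.
Context {R : realType}.
Let mu := @lebesgue_measure R.

Lemma integrable_apery_rec (D : set (measurableTypeR R)) (f : nat -> R -> R) n : measurable D ->
  (forall i, mu.-integrable D (fun x => (f i x)%:E)) ->
  mu.-integrable D (fun x => (apery_rec n (f ^~ x))%:E).
Proof.
move=> mD fi.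
have := integrableD mD (integrableB mD (integrableZl mD (n.+1%:R ^+ 2) (fi n.+1))
  (integrableZl mD (2 * n%:R ^+ 2 + 2 * n%:R + 3 / 4) (fi n)))
  (integrableZl mD (n%:R ^+ 2) (fi n.-1)).
by apply: eq_integrable.
Qed.

Lemma Rintegral_apery_rec (D : set (measurableTypeR R)) (f : nat -> R -> R) n : measurable D ->
  (forall i, mu.-integrable D (fun x => (f i x)%:E)) ->
  \int[mu]_(x in D) apery_rec n (f ^~ x) = apery_rec n (fun i => \int[mu]_(x in D) f i x).
Proof.
move=> mD fi; rewrite /apery_rec.
have iZ (c : R) i : mu.-integrable D (EFin \o (fun x => c * f i x)).
  by have := integrableZl mD c (fi i); apply: eq_integrable.
rewrite (RintegralD mD); last exact: iZ; last first.
  by have := integrableB mD (iZ (n.+1%:R ^+ 2) n.+1) (iZ (2 * n%:R ^+ 2 + 2 * n%:R + 3 / 4) n);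
    apply: eq_integrable.
rewrite (RintegralB mD (iZ _ _) (iZ _ _)).
by rewrite !RintegralZl//; exact: fi.
Qed.

(** Serves for an integrand of variable sign, where Tonelli does not apply: a bounded function on a
    rectangle of finite measure is integrable. *)
Lemma fubini_rectangle (A B : set (measurableTypeR R)) (f : R * R -> R) (C : R) :
  measurable A -> measurable B -> (mu A < +oo)%E -> (mu B < +oo)%E ->
  measurable_fun [set: R * R] f -> (forall x y, A x -> B y -> `|f (x, y)| <= C) ->
  (\int[mu]_(x in A) \int[mu]_(y in B) (f (x, y))%:E =
   \int[mu]_(y in B) \int[mu]_(x in A) (f (x, y))%:E)%E.
Proof.
move=> mA mB fA fB mf bf.
have mAB : measurable (A `*` B : set (measurableTypeR R * measurableTypeR R)).
  exact: measurableX.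
pose g := (EFin \o f) \_ (A `*` B).
have ig : (mu \x mu)%E.-integrable [set: measurableTypeR R * measurableTypeR R] g.
  apply/(integrable_mkcond _ mAB).
  apply: measurable_bounded_integrable => //.
  - rewrite [X in (X < _)%E](product_measure1E mu mu mA mB).
    by rewrite lte_mul_pinfty// ge0_fin_numE.
  - exact: measurable_funTS.
  - exists C; split; first exact: num_real.
    by move=> M CM [x y] [/= Ax By]; exact: le_trans (bf _ _ Ax By) (ltW CM).
have mg : measurable_fun [set: measurableTypeR R * measurableTypeR R] g.
  by case/integrableP : ig.
have gE x y : g (x, y) = if x \in A then (if y \in B then (f (x, y))%:E else 0%E) else 0%E.
  rewrite /g patchE; case: ifPn => [/set_mem[/= Ax By]|/negP h].
    by rewrite !mem_set.
  case: ifPn => [/set_mem Ax|//]; case: ifPn => [/set_mem By|//].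
  by exfalso; apply/h/mem_set; split.
have := Fubini ig.
rewrite (_ : (\int[mu]_x \int[mu]_y g (x, y))%E =
    (\int[mu]_(x in A) \int[mu]_(y in B) (f (x, y))%:E)%E); last first.
  rewrite [RHS]integral_mkcond; apply: eq_integral => x _.
  rewrite patchE; case: ifPn => xA.
    rewrite [RHS]integral_mkcond; apply: eq_integral => y _.
    by rewrite gE xA patchE.
  by rewrite integral0_eq// => y _; rewrite gE (negbTE xA).
move=> ->.
rewrite [RHS]integral_mkcond; apply: eq_integral => y _.
rewrite patchE; case: ifPn => yB.
  rewrite [RHS]integral_mkcond; apply: eq_integral => x _.
  by rewrite gE yB patchE; case: ifPn.
by rewrite integral0_eq// => x _; rewrite gE (negbTE yB); case: ifPn.
Qed.

Notation I01 := (`]0%R, 1%R[%classic : set R).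

Lemma expRN_lt1 N : expR (- N.+1%:R) < 1 :> R.
Proof. by rewrite expR_lt1 oppr_lt0. Qed.

Lemma cvg_Rintegral_exp (g : R -> R) :
  mu.-integrable I01 (fun x => (g x)%:E) -> (forall x, I01 x -> 0 <= g x) ->
  \int[mu]_(x in `]expR (- N.+1%:R), 1[) g x @[N --> \oo] --> \int[mu]_(x in I01) g x.
Proof.
move=> ig g0.
pose F (N : nat) : set (measurableTypeR R) := `]expR (- N.+1%:R), 1[%classic.
have FI N : F N `<=` I01.
  move=> x; rewrite /F /= !in_itv/= => /andP[ex ->]; rewrite andbT.
  exact: lt_trans (expR_gt0 _) ex.
have UF : \bigcup_N F N = I01.
  apply/seteqP; split; first by move=> x [N _ /FI].
  move=> x /=; rewrite in_itv/= => /andP[x0 x1].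
  (* [exp(-(N+1)) < x] means [- ln x < N + 1], which holds for the integer part of [- ln x]. *)
  exists (Num.trunc (- ln x)) => //=; rewrite /F/= in_itv/= x1 andbT.
  rewrite -[ltRHS](@lnK _ x) ?posrE// ltr_expR ltrNl.
  by apply: truncnS_gt.
have mI : measurable (I01 : set (measurableTypeR R)) by exact: measurable_itv.
have mg : measurable_fun (I01 : set (measurableTypeR R)) (fun x => (g x)%:E) by case/integrableP : ig.
have cF : (\int[mu]_(x in F N) (g x)%:E)%E @[N --> \oo] --> (\int[mu]_(x in I01) (g x)%:E)%E.
  rewrite -UF; apply: ge0_nondecreasing_set_cvg_integral.
  - move=> a b ab; apply/subsetPset => x; rewrite /F /= !in_itv/= => /andP[ex ->].
    rewrite andbT; apply: le_lt_trans ex; rewrite ler_expR lerN2 ler_nat ltnS//.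
  - by move=> N; exact: measurable_itv.
  - by move=> N; apply: measurable_funS mg => //; exact: FI.
  - by move=> N x /FI /g0; rewrite lee_fin.
have fE : (\int[mu]_(x in I01) (g x)%:E)%E = (\int[mu]_(x in I01) g x)%:E.
  by rewrite /Rintegral fineK//; exact: integrable_fin_num ig.
by rewrite fE in cF; apply: fine_cvg cF.
Qed.

(** From [x^(i+1) / (i+1)! <= exp x], the sequence is at most [(i+1)! / (N+1)]. *)
Lemma cvg_expRN_exp i : N.+1%:R ^+ i * expR (- N.+1%:R) @[N --> \oo] --> (0 : R).
Proof.
apply: (@squeeze_cvgr _ _ _ _ (fun=> 0) (fun N => i.+1`!%:R * N.+1%:R^-1)).
- near=> N; rewrite mulr_ge0 ?exprn_ge0 ?expR_ge0//=.
  have N0 : 0 < N.+1%:R :> R by [].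
  rewrite ler_pdivlMr// expRN mulrAC -exprSr ler_pdivrMr ?expR_gt0//.
  rewrite mulrC -ler_pdivrMr ?ltr0n ?fact_gt0//.
  by apply: le_trans (expR_ge1Dxn i (ltW N0)); rewrite lerDr.
- exact: cvg_cst.
- rewrite -[0 in X in _ --> X](mulr0 (i.+1`!%:R)); apply: cvgMr.
  exact: cvg_harmonic.
Unshelve. all: by end_near. Qed.

End integral_tools.

(** * The recurrence for [J] by two integrations by parts *)

Section recurrence.
Context {R : realType}.
Let mu := @lebesgue_measure R.
Notation I01 := (`]0%R, 1%R[%classic : set R).
Notation Im := (`[(-1)%R, 1%R]%classic : set R).
Implicit Types p y e : R.

Lemma measurable_Im : measurable (Im : set (measurableTypeR R)).
Proof. exact: measurable_itv. Qed.

Lemma continuous_wfun_y p y : 0 < p -> {for y, continuous (wfun p)}.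
Proof.
move=> p0; have ds := hasder_sfun_y y p0; have dy2 := hasderX 2 (hasder_id y).
apply: hasder_continuous; apply: hasderB.
  exact: hasderM (hasderM (hasder_cst _ _) dy2) (hasderX 3 ds).
exact: hasderM (hasderM (hasderM (hasder_cst 3 _) (hasderM (hasder_cst _ _) dy2))
  (hasderB (hasder_cst _ _) (hasderM (hasder_cst _ _) dy2))) (hasderX 5 ds).
Qed.

Lemma continuous_q n y : {for y, continuous (fun y => (1 - y ^+ 2) ^+ n)}.
Proof. exact: hasder_continuous (hasder_q n y). Qed.

Lemma continuous_qwfun n p : 0 < p -> continuous (fun y => (1 - y ^+ 2) ^+ n * wfun p y).
Proof. by move=> p0 y; apply: cvgM; [exact: continuous_q|exact: continuous_wfun_y]. Qed.

Lemma ypot_edge n p y : y ^+ 2 = 1 -> ypot n p y = 0.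
Proof.
move=> y1; rewrite /ypot y1 subrr; case: n => [|n]; first by rewrite expr0; ring.
by rewrite exprS; ring.
Qed.

(** [hasder_ypot] integrated over [[-1, 1]]: [ypot] is zero at both ends. *)
Lemma apery_rec_bint n p : 0 < p ->
  apery_rec n (bint ^~ p) = (\int[mu]_(y in Im) ((1 - y ^+ 2) ^+ n * wfun p y)) / 4.
Proof.
move=> p0.
have ib i : mu.-integrable Im (fun y => ((1 - y ^+ 2) ^+ i * sfun p y)%:E) by exact: bint_integrable.
have iw : mu.-integrable Im (EFin \o (fun y => (1 - y ^+ 2) ^+ n * wfun p y)).
  by apply: continuous_integrable_Im; exact: continuous_qwfun.
have ia := integrable_apery_rec n measurable_Im ib.
have iw4 : mu.-integrable Im (EFin \o (fun y => (1 - y ^+ 2) ^+ n * wfun p y / 4)).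
  by have := integrableZr measurable_Im (4^-1) iw; apply: eq_integrable.
have := @hasder_FTC R (fun y => apery_rec n (fun i => (1 - y ^+ 2) ^+ i * sfun p y)
    - (1 - y ^+ 2) ^+ n * wfun p y / 4) (ypot n p) (-1) 1.
rewrite !ypot_edge ?sqrrN ?expr1n// subrr => /(_ _ _ _)/(congr1 fine)/= h.
suff : \int[mu]_(y in Im) (apery_rec n (fun i => (1 - y ^+ 2) ^+ i * sfun p y)
    - (1 - y ^+ 2) ^+ n * wfun p y / 4) = 0.
  rewrite (RintegralB measurable_Im ia iw4) (Rintegral_apery_rec n measurable_Im ib).
  by rewrite (RintegralZr _ measurable_Im iw) => /eqP; rewrite subr_eq0 => /eqP.
apply: h.
- by lra.
- move=> y _; apply: cvgB; last first.
    by apply: cvgM; [exact: continuous_qwfun|exact: cvg_cst].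
  have cb i : {for y, continuous (fun y => (1 - y ^+ 2) ^+ i * sfun p y)}.
    exact: continuous_bint_integrand.
  apply: cvgD; first apply: cvgB; by apply: cvgM; [exact: cvg_cst|exact: cb].
- by move=> y _; exact: hasder_ypot.
Qed.

Lemma lwt_ge0 k p : 0 < p -> p <= 1 -> 0 <= lwt k p.
Proof. by case: k => [|[|k]]// p0 p1; rewrite lwt_lnpow// lnpow_ge0. Qed.

Lemma lwt_le k e p : 0 < e -> e <= p -> p <= 1 -> lwt k p <= lwt k e.
Proof.
move=> e0 ep p1; case: k => [|[|k]]//=.
rewrite ler_wpM2r ?invr_ge0//.
have p0 : 0 < p by exact: lt_le_trans e0 ep.
by rewrite lerXn2r ?nnegrE ?oppr_ge0 ?ln_le0 ?(le_trans ep)// lerN2 ler_ln ?posrE.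
Qed.

Lemma sfun_le e p y : 0 < e -> e <= p -> sfun p y <= (2 * e)^-1.
Proof.
move=> e0 ep; have p0 : 0 < p by exact: lt_le_trans e0 ep.
rewrite lef_pV2 ?posrE ?mulr_gt0 ?sqrt_disc_gt0//.
rewrite -[leLHS]ger0_norm; last by rewrite mulr_ge0 // ltW.
rewrite -sqrtr_sqr ler_wsqrtr// /disc.
have : e ^+ 2 <= p ^+ 2 by rewrite lerXn2r ?nnegrE// ltW.
have : 0 <= (1 - p ^+ 2) ^+ 2 * y ^+ 2 by rewrite mulr_ge0 ?sqr_ge0.
by rewrite exprMn; lra.
Qed.

Lemma y2_le1 y : Im y -> 0 <= y ^+ 2 <= 1.
Proof. by move=> /q_ge0; rewrite subr_ge0 sqr_ge0. Qed.

(** Amounts to [(1 - p^4) y^2 <= disc p y]. It keeps [hpot] near [p = 0] down to the size of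
    [p * sfun p y] times logarithms, although [vfun] contains the cube of [sfun]. *)
Lemma vfun_bound p y : 0 < p -> p <= 1 -> Im y -> 0 <= vfun p y <= sfun p y.
Proof.
move=> p0 p1 /y2_le1/andP[y0 y1]; have s0 := sfun_gt0 y p0.
have p2 : 0 <= p ^+ 2 <= 1 by rewrite sqr_ge0 exprn_ile1// ltW.
have p4 : p ^+ 4 = p ^+ 2 * p ^+ 2 by rewrite -exprD.
have c0 : 0 <= (1 - p ^+ 4) * y ^+ 2 by rewrite mulr_ge0// p4; nra.
rewrite /vfun mulr_ge0 ?exprn_ge0 ?(ltW s0)//=.
rewrite [leRHS]sfunE3// mulrC ler_wpM2l ?exprn_ge0 ?(ltW s0)//.
rewrite /disc p4.
move: (p ^+ 2) (y ^+ 2) p2 y0 y1 {c0 p4} => a b /andP[a0 a1] b0 b1.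
have h1 : 0 <= a * (1 - b) by apply: mulr_ge0 => //; rewrite subr_ge0.
have h2 : 0 <= a * a * b by apply: mulr_ge0 => //; apply: mulr_ge0.
by rewrite -subr_ge0 (_ : _ - _ = 2 * a + 2 * (a * (1 - b)) + 2 * (a * a * b)); [lra|ring].
Qed.

(** A crude bound, used only at fixed [e] to justify Fubini; its growth as [e] tends to 0 does no
    harm. *)
Lemma wfun_bound e p y : 0 < e -> e <= p -> p <= 1 -> Im y ->
  `|wfun p y| <= 4 * (2 * e)^-1 ^+ 3 + 12 * (2 * e)^-1 ^+ 5.
Proof.
move=> e0 ep p1 /y2_le1/andP[y0 y1].
have p0 : 0 < p by exact: lt_le_trans e0 ep.
have s0 := ltW (sfun_gt0 y p0); have se := sfun_le y e0 ep.
have se_ k : sfun p y ^+ k <= (2 * e)^-1 ^+ k.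
  by rewrite lerXn2r ?nnegrE// invr_ge0 mulr_ge0// ltW.
have p2 : 0 <= p ^+ 2 <= 1 by rewrite sqr_ge0 exprn_ile1// ltW.
have p4 : 0 <= p ^+ 4 <= 1 by rewrite exprn_ge0 ?exprn_ile1// ltW.
have s_ge0 k : 0 <= sfun p y ^+ k by rewrite exprn_ge0.
rewrite /wfun (_ : 3 * _ * _ = 3 * (p ^+ 2 * (1 - p ^+ 4) * y ^+ 2)
  * (4 - 2 * (1 - p ^+ 2) * y ^+ 2)); last by ring.
move: (p ^+ 2) (p ^+ 4) (y ^+ 2) p2 p4 y0 y1 => a c b /andP[a0 a1] /andP[c0 c1] b0 b1.
apply: le_trans (ler_normB _ _) _; rewrite !(normrM _ (_ ^+ _)).
rewrite !(ger0_norm (s_ge0 _)).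
have h1 : `|(1 - 5 * c) * b| <= 4.
  have i1 : 0 <= c * b by exact: mulr_ge0.
  have i2 : 0 <= (1 - c) * b by apply: mulr_ge0 => //; rewrite subr_ge0.
  by rewrite ler_norml; apply/andP; split; lra.
have h2 : `|3 * (a * (1 - c) * b) * (4 - 2 * (1 - a) * b)| <= 12.
  have d0 : 0 <= 1 - c by rewrite subr_ge0.
  have d1 : 1 - c <= 1 by lra.
  have t0 : 0 <= a * (1 - c) * b by do 2! apply: mulr_ge0 => //.
  have t1 : a * (1 - c) * b <= 1 by rewrite mulr_ile1// ?mulr_ge0// mulr_ile1.
  have u0 : 0 <= (1 - a) * b by apply: mulr_ge0 => //; rewrite subr_ge0.
  have u1 : (1 - a) * b <= 1 by rewrite mulr_ile1// ?subr_ge0//; lra.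
  have v0 : 0 <= 4 - 2 * (1 - a) * b by lra.
  have v1 : 4 - 2 * (1 - a) * b <= 4 by lra.
  rewrite ger0_norm; last by rewrite mulr_ge0// mulr_ge0.
  rewrite (_ : 12 = 3 * 4); last by ring.
  by apply: ler_pM => //; [rewrite mulr_ge0|lra].
by apply: lerD; apply: ler_pM.
Qed.

(** The [p]-derivative of [(1 - y^2)^n * hpot j p y]. Computing its double integral in both orders
    yields the recurrence. *)
Definition dpot j n p y := (1 - y ^+ 2) ^+ n * (lwt j.+2 p * wfun p y - lwt j p * sfun p y).

Lemma continuous_dpot_y j n p : 0 < p -> continuous (dpot j n p).
Proof.
move=> p0 y; apply: cvgM; first exact: continuous_q.
apply: cvgB; (apply: cvgM; first exact: cvg_cst).
  exact: continuous_wfun_y.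
exact: hasder_continuous (hasder_sfun_y y p0).
Qed.

Lemma continuous_lwt k p : 0 < p -> {for p, continuous (lwt k)}.
Proof.
move=> p0; case: k => [|k]; first exact: cst_continuous.
exact: hasder_continuous (hasder_lwt k p0).
Qed.

Lemma continuous_wfun_p p y : 0 < p -> {for p, continuous (wfun ^~ y)}.
Proof.
move=> p0; have ds := hasder_sfun_p y p0; have dX k := hasderX k (hasder_id p).
apply: hasder_continuous; apply: hasderB.
  exact: hasderM (hasderM (hasderB (hasder_cst 1 p) (hasderM (hasder_cst 5 p) (dX 4%N)))
    (hasder_cst (y ^+ 2) p)) (hasderX 3 ds).
exact: hasderM (hasderM (hasderM (hasder_cst 3 p) (hasderM (hasderM (hasder_id p)
  (hasderB (hasder_cst 1 p) (dX 4%N))) (hasder_cst (y ^+ 2) p)))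
  (hasderB (hasderM (hasder_cst 4 p) (hasder_id p)) (hasderM (hasderM
  (hasderM (hasder_cst 2 p) (hasder_id p)) (hasderB (hasder_cst 1 p) (dX 2%N)))
  (hasder_cst (y ^+ 2) p)))) (hasderX 5 ds).
Qed.

Lemma continuous_dpot_p j n p y : 0 < p -> {for p, continuous (fun p => dpot j n p y)}.
Proof.
move=> p0; apply: cvgM; first exact: cvg_cst.
apply: cvgB; (apply: cvgM; first exact: continuous_lwt).
  exact: continuous_wfun_p.
exact: hasder_continuous (hasder_sfun_p y p0).
Qed.

Lemma measurable_lwt d (T : measurableType d) (f : T -> R) k :
  measurable_fun [set: T] f -> measurable_fun [set: T] (fun x => lwt k (f x)).
Proof.
move=> mf; case: k => [|[|k]] /=; [exact: measurable_cst|exact: measurable_cst|].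
apply: measurable_funM; last exact: measurable_cst.
apply: measurable_funX; apply: measurable_funN.
exact: (measurableT_comp (@measurable_ln R) mf).
Qed.

Lemma measurable_dpot j n : measurable_fun [set: R * R] (fun z : R * R => dpot j n z.1 z.2).
Proof.
have m1 : measurable_fun [set: R * R] (fst : R * R -> R) by exact: measurable_fst.
have m2 : measurable_fun [set: R * R] (snd : R * R -> R) by exact: measurable_snd.
have ms := @measurable_sfun R.
have mc c : measurable_fun [set: R * R] (fun=> c : R) by exact: measurable_cst.
apply: measurable_funM; first exact: measurable_q.
apply: measurable_funB; (apply: measurable_funM; first exact: measurable_lwt); last exact: ms.
have m1X k : measurable_fun [set: R * R] (fun z => z.1 ^+ k : R) by exact: measurable_funX.
have m2X k : measurable_fun [set: R * R] (fun z => z.2 ^+ k : R) by exact: measurable_funX.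
apply: measurable_funB; (apply: measurable_funM; last exact: measurable_funX).
  apply: measurable_funM; last exact: m2X.
  by apply: measurable_funB; [exact: mc|apply: measurable_funM; [exact: mc|exact: m1X]].
apply: measurable_funM.
  apply: measurable_funM; first exact: mc.
  apply: measurable_funM; last exact: m2X.
  apply: measurable_funM; first exact: m1.
  by apply: measurable_funB; [exact: mc|exact: m1X].
apply: measurable_funB; first by apply: measurable_funM; [exact: mc|exact: m1].
apply: measurable_funM; last exact: m2X.
apply: measurable_funM; first by apply: measurable_funM; [exact: mc|exact: m1].
by apply: measurable_funB; [exact: mc|exact: m1X].
Qed.

Lemma dpot_bound j n e p y : 0 < e -> e <= p -> p <= 1 -> Im y ->
  `|dpot j n p y| <= lwt j.+2 e * (4 * (2 * e)^-1 ^+ 3 + 12 * (2 * e)^-1 ^+ 5)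
    + lwt j e * (2 * e)^-1.
Proof.
move=> e0 ep p1 Iy; have p0 : 0 < p by exact: lt_le_trans e0 ep.
rewrite /dpot normrM ger0_norm ?exprn_ge0 ?q_ge0//.
apply: (@le_trans _ _ (1 * `|lwt j.+2 p * wfun p y - lwt j p * sfun p y|)).
  by apply: ler_wpM2r => //; rewrite exprn_ile1 ?q_ge0 ?q_le1.
rewrite mul1r; apply: le_trans (ler_normB _ _) _.
rewrite (normrM (lwt j.+2 p)) (normrM (lwt j p)).
apply: lerD; apply: ler_pM => //; rewrite ?(ger0_norm (lwt_ge0 _ p0 p1)) ?lwt_le//.
  exact: wfun_bound.
by rewrite (ger0_norm (ltW (sfun_gt0 y p0))) sfun_le.
Qed.

Definition qint n : R := \int[mu]_(y in Im) (1 - y ^+ 2) ^+ n.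

Lemma integrable_q n : mu.-integrable Im (EFin \o (fun y : R => (1 - y ^+ 2) ^+ n)).
Proof. by apply: continuous_integrable_Im => y; exact: continuous_q. Qed.

Lemma Rintegral_dpot_y j n p : 0 < p ->
  \int[mu]_(y in Im) dpot j n p y =
  lwt j.+2 p * (4 * apery_rec n (bint ^~ p)) - lwt j p * bint n p.
Proof.
move=> p0.
have iw : mu.-integrable Im (EFin \o (fun y => (1 - y ^+ 2) ^+ n * wfun p y)).
  by apply: continuous_integrable_Im; exact: continuous_qwfun.
have ib := bint_integrable n p0.
have iw' := integrableZl measurable_Im (lwt j.+2 p) iw.
have ib' := integrableZl measurable_Im (lwt j p) ib.
transitivity (\int[mu]_(y in Im) (lwt j.+2 p * ((1 - y ^+ 2) ^+ n * wfun p y)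
    - lwt j p * ((1 - y ^+ 2) ^+ n * sfun p y))).
  by apply: eq_Rintegral => y _; rewrite /dpot; ring.
rewrite (RintegralB measurable_Im); last first.
- by apply: eq_integrable ib'.
- by apply: eq_integrable iw'.
rewrite (RintegralZl _ measurable_Im iw) (RintegralZl _ measurable_Im ib).
by rewrite apery_rec_bint// [4 * _]mulrC divfK.
Qed.

Lemma Rintegral_dpot_p j n e y : 0 < e -> e < 1 ->
  (\int[mu]_(p in `]e, 1%R[) (dpot j n p y)%:E)%E =
  ((1 - y ^+ 2) ^+ n * (hpot j 1 y - hpot j e y))%:E.
Proof.
move=> e0 e1.
rewrite -(@integral_itv_bndoo _ e 1 _ true false); last first.
  apply/measurable_EFinP/measurable_funTS.
  exact: (measurableT_comp (measurable_dpot j n) (measurable_pair2 y)).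
rewrite (@hasder_FTC _ _ (fun p => (1 - y ^+ 2) ^+ n * hpot j p y))//.
- by rewrite mulrBr.
- move=> p; rewrite in_itv/= => /andP[ep _]; apply: continuous_dpot_p.
  exact: lt_le_trans e0 ep.
- move=> p /andP[ep _]; have p0 := lt_le_trans e0 ep.
  by apply: hasder_eq (hasderM (hasder_cst _ _) (hasder_hpot j y p0)) _; rewrite /dpot; ring.
Qed.

Lemma continuous_hpot j p : 0 < p -> continuous (hpot j p).
Proof.
move=> p0 y; have ds := hasder_sfun_y y p0; apply: hasder_continuous; apply: hasderD.
  exact: hasderM (hasder_cst _ _) (hasderM (hasder_cst _ _)
    (hasderM (hasderM (hasder_cst _ _) (hasderX 2 (hasder_id y))) (hasderX 3 ds))).
exact: hasderM (hasder_cst _ _) (hasderM (hasder_cst _ _) ds).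
Qed.

Lemma integrable_qhpot j n p : 0 < p ->
  mu.-integrable Im (EFin \o (fun y => (1 - y ^+ 2) ^+ n * hpot j p y)).
Proof.
move=> p0; apply: continuous_integrable_Im => y.
by apply: cvgM; [exact: continuous_q|exact: continuous_hpot].
Qed.

Definition psi j n p := lwt j.+2 p * (4 * apery_rec n (bint ^~ p)) - lwt j p * bint n p.

(** [psi] is the [y]-integral of [dpot]; in the other order the inner [p]-integral is a difference
    of boundary values of [hpot]. *)
Lemma Rintegral_psi j n e : 0 < e -> e < 1 ->
  \int[mu]_(p in `]e, 1[) psi j n p =
  (if j == 1%N then 2^-1 * qint n else 0) - \int[mu]_(y in Im) ((1 - y ^+ 2) ^+ n * hpot j e y).
Proof.
move=> e0 e1.
have mA : measurable (`]e, 1[%classic : set (measurableTypeR R)) by exact: measurable_itv.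
transitivity (fine (\int[mu]_(p in `]e, 1%R[) \int[mu]_(y in Im) (dpot j n p y)%:E)%E).
  congr fine; apply: eq_integral => p /set_mem/=; rewrite in_itv/= => /andP[ep _].
  have p0 := lt_trans e0 ep.
  rewrite /psi -Rintegral_dpot_y// /Rintegral fineK//.
  by apply: integrable_fin_num => //; apply: continuous_integrable_Im; exact: continuous_dpot_y.
rewrite (@fubini_rectangle R _ _ (fun z => dpot j n z.1 z.2)
  (lwt j.+2 e * (4 * (2 * e)^-1 ^+ 3 + 12 * (2 * e)^-1 ^+ 5) + lwt j e * (2 * e)^-1))//; last 4 first.
- by rewrite lebesgue_measure_itv/= lte_fin e1 ltry.
- by rewrite lebesgue_measure_itv/= lte_fin; case: ifPn; rewrite ltry.
- exact: measurable_dpot.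
- move=> p y /=; rewrite in_itv/= => /andP[/ltW ep /ltW p1] Iy; exact: dpot_bound.
have i1 := integrable_qhpot j n ltr01; have ie := integrable_qhpot j n e0.
transitivity (\int[mu]_(y in Im) ((1 - y ^+ 2) ^+ n * hpot j 1 y - (1 - y ^+ 2) ^+ n * hpot j e y)).
  by congr fine; apply: eq_integral => y _; rewrite Rintegral_dpot_p//= mulrBr.
rewrite (RintegralB measurable_Im i1 ie); congr (_ - _).
under eq_Rintegral do rewrite hpot1.
case: ifPn => _; last by under eq_Rintegral do rewrite mulr0; rewrite Rintegral_cst ?mul0r//; exact: measurable_Im.
by rewrite (RintegralZr _ measurable_Im (integrable_q n)) mulrC.
Qed.

Lemma qhpot_bound j n e : 0 < e -> e < 1 ->
  `|\int[mu]_(y in Im) ((1 - y ^+ 2) ^+ n * hpot j e y)| <=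
  (lwt j.+2 e + lwt j.+1 e) * e * (2 * (1 + lnpow 1 e)).
Proof.
move=> e0 e1.
have l2 := lwt_ge0 j.+2 e0 (ltW e1); have l1 := lwt_ge0 j.+1 e0 (ltW e1).
apply: le_trans (le_normr_Rintegral measurable_Im (integrable_qhpot j n e0)) _.
apply: (@le_trans _ _ (\int[mu]_(y in Im) ((lwt j.+2 e + lwt j.+1 e) * e * ((1 - y ^+ 2) ^+ n * sfun e y)))).
  apply: le_Rintegral.
  - exact: measurable_Im.
  - exact: integrable_norm (integrable_qhpot j n e0).
  - by have := integrableZl measurable_Im ((lwt j.+2 e + lwt j.+1 e) * e) (bint_integrable n e0);
      apply: eq_integrable.
  - move=> y Iy; have /andP[v0 vs] := vfun_bound e0 (ltW e1) Iy.
    have s0 := ltW (sfun_gt0 y e0); have e0' := ltW e0.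
    have q0 : 0 <= (1 - y ^+ 2) ^+ n by rewrite exprn_ge0 ?q_ge0.
    rewrite ger0_norm; last first.
      by apply: mulr_ge0 => //; apply: addr_ge0; apply: mulr_ge0 => //; exact: mulr_ge0.
    rewrite mulrCA; apply: ler_wpM2l => //.
    rewrite -mulrA mulrDl lerD2r; apply: ler_wpM2l => //.
    by apply: ler_wpM2l.
rewrite (RintegralZl _ measurable_Im (bint_integrable n e0)).
by apply: ler_wpM2l; [rewrite mulr_ge0 ?addr_ge0 ?(ltW e0)|exact: bint_bound].
Qed.

Lemma qhpot_cvg0 j n :
  \int[mu]_(y in Im) ((1 - y ^+ 2) ^+ n * hpot j (expR (- N.+1%:R)) y) @[N --> \oo] --> (0 : R).
Proof.
apply/cvgr0Pnorm_le => eps eps0.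
(* With [x = N + 1 = -ln e], the two weights add up to at most [2 x^(j+1)] and [1 + x <= 2 x], so
   [qhpot_bound] gives [8 x^(j+2) e]; hence the exponent and the 8. *)
have := @cvg_expRN_exp R j.+2; move/cvgr0Pnorm_le => /(_ (eps / 8) ltac:(lra)).
apply: filterS => N; have e0 := expR_gt0 (- N.+1%:R : R); have e1 := expRN_lt1 (R := R) N.
rewrite ger0_norm; last by rewrite mulr_ge0 ?exprn_ge0// ltW.
move=> hN; apply: le_trans (qhpot_bound j n e0 e1) _.
have N1 : 1 <= N.+1%:R :> R by rewrite ler1n.
have lwb k : lwt k.+1 (expR (- N.+1%:R)) <= N.+1%:R ^+ k :> R.
  case: k => [|k] /=; first by rewrite expr0.
  rewrite expRK opprK ler_pdivrMr ?ltr0n ?fact_gt0//.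
  apply: (@le_trans _ _ (N.+1%:R ^+ k.+1 * 1)).
    by rewrite mulr1 ler_weXn2l.
  by apply: ler_wpM2l; [rewrite exprn_ge0|rewrite ler1n fact_gt0].
have l1 : lnpow 1 (expR (- N.+1%:R)) = N.+1%:R :> R.
  by rewrite lnpowE// ?ltW// expRK opprK expr1 divr1.
rewrite l1; set e := expR _ in e0 e1 hN lwb *; set x := N.+1%:R in N1 hN lwb *.
have x0 : 0 <= x by lra.
have xj : x ^+ j <= x ^+ j.+1 by rewrite ler_weXn2l.
have xj0 : 0 <= x ^+ j.+1 by rewrite exprn_ge0.
apply: (@le_trans _ _ (2 * x ^+ j.+1 * e * (4 * x))).
  have l2 := lwt_ge0 j.+2 e0 (ltW e1); have l1' := lwt_ge0 j.+1 e0 (ltW e1).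
  apply: ler_pM.
  - by rewrite mulr_ge0 ?addr_ge0// ltW.
  - by lra.
  - apply: ler_wpM2r; first exact: ltW.
    by have := lwb j.+1; have := lwb j; lra.
  - by lra.
rewrite (_ : _ * _ = 8 * (x ^+ j.+2 * e)); last by rewrite [x ^+ j.+2]exprSr; ring.
by lra.
Qed.

(** The integrals of [psi] over []exp(-(N+1)), 1[] are given two limits: by linearity, the left side
    minus the integral with weight [lwt j]; by [Rintegral_psi], the boundary value at [p = 1]
    alone. *)
Lemma wint_rec j n : 4 * apery_rec n (wint j) =
  (if j == 1%N then 2^-1 * qint n else 0) + (if j is j'.+2 then wint j' n else 0).
Proof.
have mI : measurable (I01 : set (measurableTypeR R)) by exact: measurable_itv.
pose e (N : nat) : R := expR (- N.+1%:R).
have il i : mu.-integrable I01 (fun p => (lnpow j p * bint i p)%:E).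
  exact: integrable_lnpow_bint.
have FI N : `]e N, 1[%classic `<=` I01.
  move=> x; rewrite /= !in_itv/= => /andP[ex ->]; rewrite andbT.
  exact: lt_trans (expR_gt0 _) ex.
have mF N : measurable (`]e N, 1[%classic : set (measurableTypeR R)) by exact: measurable_itv.
have ilN N i : mu.-integrable `]e N, 1[ (fun p => (lnpow j p * bint i p)%:E).
  exact: (integrableS mI (mF N) (@FI N) (il i)).
have I0 p : I01 p -> 0 < p /\ p < 1 by rewrite /= in_itv/= => /andP[].
pose b p := lwt j p * bint n p.
have b0 p : I01 p -> 0 <= b p.
  by move=> /I0[p0 p1]; rewrite mulr_ge0 ?bint_ge0// lwt_ge0// ltW.
(* [j] stands for [k - 2], and [lwt 0] and [lwt 1] are zero: for [k = 2] and [k = 3] no lower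
   integral appears. *)
have [ib wb] : mu.-integrable I01 (fun p => (b p)%:E) /\
    \int[mu]_(p in I01) b p = if j is j'.+2 then wint j' n else 0.
  rewrite /b; case: (j) => [|[|j']] /=.
  - split.
      by have := integrable0 mu I01; apply: eq_integrable => // p _; rewrite /= mul0r.
    rewrite (@eq_Rintegral _ _ _ mu _ (cst 0)); last by move=> p _; rewrite /= mul0r.
    by rewrite Rintegral_cst// mul0r.
  - split.
      by have := integrable0 mu I01; apply: eq_integrable => // p _; rewrite /= mul0r.
    rewrite (@eq_Rintegral _ _ _ mu _ (cst 0)); last by move=> p _; rewrite /= mul0r.
    by rewrite Rintegral_cst// mul0r.
  - split.
      have := @integrable_lnpow_bint R j' n; apply: eq_integrable => //.
      by move=> p /set_mem/I0[p0 p1]; rewrite lnpowE// ltW.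
    by apply: eq_Rintegral => p /set_mem/I0[p0 p1]; rewrite lnpowE// ltW.
have ibN N : mu.-integrable `]e N, 1[ (fun p => (b p)%:E).
  exact: (integrableS mI (mF N) (@FI N) ib).
have psiE N : \int[mu]_(p in `]e N, 1[) psi j n p =
    4 * apery_rec n (fun i => \int[mu]_(p in `]e N, 1[) (lnpow j p * bint i p))
    - \int[mu]_(p in `]e N, 1[) b p.
  have ia := integrable_apery_rec n (mF N) (ilN N).
  have ia4 := integrableZl (mF N) 4 ia.
  rewrite -(Rintegral_apery_rec n (mF N) (ilN N)) -(RintegralZl 4 (mF N) ia).
  rewrite -(RintegralB (mF N) ia4 (ibN N)).
  apply: eq_Rintegral => p /set_mem/FI/I0[p0 p1].
  by rewrite /psi /b lwt_lnpow ?ltW// /apery_rec; ring.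
have c1 : \int[mu]_(p in `]e N, 1[) psi j n p @[N --> \oo] -->
    4 * apery_rec n (wint j) - \int[mu]_(p in I01) b p.
  rewrite (_ : (fun N => _) = fun N => 4 * apery_rec n (fun i =>
     \int[mu]_(p in `]e N, 1[) (lnpow j p * bint i p)) - \int[mu]_(p in `]e N, 1[) b p); last first.
    exact/funext.
  have cw i : \int[mu]_(p in `]e N, 1[) (lnpow j p * bint i p) @[N --> \oo] --> wint j i.
    apply: cvg_Rintegral_exp => // p /I0[p0 p1].
    by rewrite mulr_ge0 ?lnpow_ge0 ?bint_ge0.
  apply: cvgB; last exact: cvg_Rintegral_exp.
  by apply: cvgMr; apply: cvgD; [apply: cvgB|]; apply: cvgMr; exact: cw.
have c2 : \int[mu]_(p in `]e N, 1[) psi j n p @[N --> \oo] -->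
    (if j == 1%N then 2^-1 * qint n else 0) - 0.
  rewrite (_ : (fun N => _) = fun N => (if j == 1%N then 2^-1 * qint n else 0)
     - \int[mu]_(y in Im) ((1 - y ^+ 2) ^+ n * hpot j (e N) y)); last first.
    by apply/funext => N; rewrite Rintegral_psi ?expR_gt0 ?expRN_lt1.
  by apply: cvgB; [exact: cvg_cst|exact: qhpot_cvg0].
have E : 4 * apery_rec n (wint j) - \int[mu]_(p in I01) b p =
    (if j == 1%N then 2^-1 * qint n else 0) - 0 by exact: (cvg_unique _ c1 c2).
by move/eqP: E; rewrite subr0 wb subr_eq => /eqP.
Qed.

Lemma qintE n : 2^-1 * qint n = J R 1 n.
Proof.
rewrite /J; elim: n => [|n ih].
  rewrite /qint; under eq_Rintegral do rewrite expr0.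
  rewrite Rintegral_cst; last exact: measurable_Im.
  rewrite [fine _](_ : _ = 2 :> R); last first.
    rewrite (_ : 2 = fine (@lebesgue_measure R Im))//.
    by rewrite lebesgue_measure_itv/= lte_fin ifT ?opprK//; lra.
  by rewrite /odd_dfact big_ord1 expn0 fact0 muln0 add0n /=; field.
have rec : (2 * n.+1 + 1)%:R * qint n.+1 = (2 * n.+1)%:R * qint n.
  (* The Wallis reduction: with [m = n + 1], the derivative of [y (1 - y^2)^m] is [(2m + 1) (1 -
     y^2)^m - 2m (1 - y^2)^(m-1)], and the primitive vanishes at both ends. *)
  have h := @hasder_FTC R (fun y => (2 * n.+1 + 1)%:R * (1 - y ^+ 2) ^+ n.+1
     - (2 * n.+1)%:R * (1 - y ^+ 2) ^+ n) (fun y => y * (1 - y ^+ 2) ^+ n.+1) (-1) 1.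
  have iZ (c : R) i : mu.-integrable Im (EFin \o (fun y => c * (1 - y ^+ 2) ^+ i)).
    by have := integrableZl measurable_Im c (integrable_q i); apply: eq_integrable.
  apply/eqP; rewrite -subr_eq0 -!(RintegralZl _ measurable_Im (integrable_q _)).
  rewrite -(RintegralB measurable_Im (iZ _ _) (iZ _ _)); apply/eqP.
  rewrite /Rintegral h/=.
  - by rewrite sqrrN !expr1n subrr expr0n/= !mulr0 subr0.
  - by lra.
  - move=> y _; apply: cvgB; by apply: cvgM; [exact: cvg_cst|exact: continuous_q].
  - move=> y _; apply: hasder_eq (hasderM (hasder_id y) (hasder_q n.+1 y)) _ => /=.
    by rewrite !natrD !natrM -natr1 exprS; ring.
have -> : odd_dfact n.+1 = (odd_dfact n * (2 * n.+1 + 1))%N by rewrite /odd_dfact big_ord_recr.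
have d0 : (odd_dfact n)%:R != 0 :> R.
  rewrite pnatr_eq0 -lt0n /odd_dfact; apply: prodn_gt0 => i; by rewrite addn1.
have e0 : (2 * n.+1 + 1)%:R != 0 :> R by rewrite addn1 pnatr_eq0.
apply: (mulfI e0); rewrite mulrCA rec mulrCA ih factS expnS !natrM.
move: (2 * n.+1 + 1)%:R e0 (odd_dfact n)%:R d0 => E E0 D D0.
by field; rewrite D0 E0.
Qed.

Lemma J_rec k n : (2 <= k)%N -> apery_rec n (J R k) = J R (k - 2) n.
Proof.
case: k => [|[|j]] // _; rewrite subSS subSS subn0.
have -> : apery_rec n (J R j.+2) = 2 ^+ j.+1 * apery_rec n (wint j).
  by rewrite /apery_rec !JE; ring.
have := wint_rec j n.
(* The factor 4 of [wint_rec] is the quotient of the powers of 2 attached to [k] and [k - 2]. The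
   three cases are [J_0 = 0], the boundary term [J_1], and a genuine lower integral. *)
case: j => [|[|j]] h; rewrite /= ?addr0 ?add0r in h.
- by rewrite /J expr1; lra.
- by rewrite -qintE expr2; lra.
- by rewrite JE -h 2!exprS; ring.
Qed.

Lemma J_bound k n : (2 <= k)%N -> `|J R k n| <= J R k 0.
Proof.
case: k => [|[|j]] // _; rewrite !JE.
have w0 i : 0 <= wint j i.
  apply: Rintegral_ge0 => p /=; rewrite in_itv/= => /andP[p0 _].
  by rewrite mulr_ge0 ?lnpow_ge0 ?bint_ge0.
rewrite ger0_norm; last by apply: mulr_ge0; [exact: exprn_ge0|exact: w0].
apply: ler_wpM2l; first exact: exprn_ge0.
apply: le_Rintegral; [exact: measurable_itv|exact: integrable_lnpow_bint..|].
move=> p /=; rewrite in_itv/= => /andP[p0 _].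
by rewrite ler_wpM2l ?lnpow_ge0 ?bint_le.
Qed.

End recurrence.

Unset Implicit Arguments.

Theorem theorem3p5 (R : realType) (k : nat) (hk : (2 <= k)%N) :
  (forall n r : nat, (1 <= r < k)%N ->
     (lebesgue_tuple R k).-integrable (unit_cube R k)
       (fun u => (J_integrand n r u)%:E)) /\
  (forall z : Cplx R, `|z| < 1 ->
     [/\ cvgn (series (w_term R k z)),
         cvgn (series (w_term R (k - 2) z)),
         derivable (w R k) z 1,
         derivable (derive1 (w R k)) z 1 &
         z * (1 - z) ^+ 2 * derive1 (derive1 (w R k)) z
           + (1 - z) * (1 - 3 * z) * derive1 (w R k) z
           + (z - 3 / 4) * w R k z
         = w R (k - 2) z]).
Proof.
split=> [n r rk|z z1]; first exact: J_integrable.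
exact: (@recurrence_ode R (J R k) (J R (k - 2)) (J R k 0) z
  (fun n => J_bound n hk) (fun n => J_rec n hk) z1).
Qed.
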